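(* Let $n_1,\dots,n_m\in\mathbb{N}$, and let $\mathcal{T}$ be the following spherically symmetric rooted tree: there is a root with $n_m$ children, each child has $n_{m-1}$ children and so on (so there are $n_1\cdots n_m$ leaves). The automorphism group $\mathrm{Aut}(\mathcal{T})=\mathcal{W}_{n_1,\dots,n_m}(\{1\})$ acts on the set $\mathcal{T}_0$ of its leaves. The permutation character $\#\mathrm{fix}(\mathrm{Aut}(\mathcal{T})\curvearrowright\mathcal{T}_0)$ of this action and the natural character $\#\mathrm{fix}(S_{n_m}\curvearrowright[n_m])$ are close in the following sense: for every word $w\in F_r$ of length at most $\min\{n_i\}_{i=1}^m$, $$\left|\mathbb{E}_w\left[\#\mathrm{fix}\left(\mathrm{Aut}(\mathcal{T})\curvearrowright\mathcal{T}_0\right)\right]-\mathbb{E}_w\left[\#\mathrm{fix}\left(S_{n_m}\curvearrowright[n_m]\right)\right]\right|=O\left((n_{m-1}n_m)^{1-\pi(w)}\right),$$ where the implied constant depends on $m,w$.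
   Context: $F_r$ is the free group with basis $b_1,\dots,b_r$, and the length of a word is its number of letters in reduced form; $[n]=\{1,\dots,n\}$. The appearance of $n_{m-1}$ presupposes $m\ge2$. $\mathcal{W}_{n_1,\dots,n_m}(\{1\})=(\cdots((\{1\}\wr S_{n_1})\wr S_{n_2})\cdots)\wr S_{n_m}$ is the iterated wreath product, where $G\wr S_n=G^n\rtimes S_n$ with $S_n$ permuting the coordinates of $G^n$; it is the automorphism group of the rooted tree $\mathcal{T}$. For a finite group $\Sigma$ acting on a finite set $X$, $\#\mathrm{fix}(\Sigma\curvearrowright X):\Sigma\to\mathbb{C}$ is the permutation character $g\mapsto\#\{x\in X: gx=x\}$. For a function $f$ on a finite group $\Sigma$, $\mathbb{E}_w[f]=\mathbb{E}_\alpha[f(\alpha(w))]$, where $\alpha$ is a uniformly random homomorphism $F_r\to\Sigma$. An element of a free group $H$ is primitive if it belongs to some basis of $H$. The primitivity rank is $\pi(w)=\min\{\mathrm{rk}(H): w\in H\le F_r,\ w\text{ is not primitive in }H\}$, with $\min\emptyset=\infty$; a power with exponent $-\infty$ is read as $0$.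
   Formalization: For the trivial word w = 1 the bound is claimed only when m = 2: for w = 1 and m ≥ 3 it is false, since π(1) = 0 and |n_1⋯n_m − n_m| is unbounded as n_1 → ∞ with n_2, …, n_m = 2 fixed. *)

(* Defs.v *)
From HB Require Import structures.
From mathcomp Require Import all_boot all_order all_fingroup all_algebra.
From mathcomp Require Import all_solvable all_field.
From mathcomp Require Import boolp.

Set Implicit Arguments.
Unset Strict Implicit.
Unset Printing Implicit Defensive.

Import Order.TTheory GRing.Theory Num.Theory.

Local Open Scope group_scope.

(* A letter [(i, false)] is the generator b_i and [(i, true)] its inverse. *)
Section FreeGroup.
Variable I : choiceType.
Implicit Types (a c : I * bool) (s t : seq (I * bool)).

Definition letter_inv a := (a.1, ~~ a.2).

Lemma letter_invK : involutive letter_inv.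
Proof. by case=> i b; rewrite /letter_inv negbK. Qed.

Definition reduced s := sorted (fun a c => c != letter_inv a) s.

Record freegroup := FreeGroup { word :> seq (I * bool); _ : reduced word }.

HB.instance Definition _ := [isSub for word].
HB.instance Definition _ := [Choice of freegroup by <:].

Definition red_cons a s :=
  if s is c :: s' then if c == letter_inv a then s' else a :: s else [:: a].

Lemma reduced_cons a s : reduced s -> reduced (red_cons a s).
Proof.
case: s => [//|c s] rs /=; case: ifP => [_|/negbT ca]; last exact/andP.
exact: path_sorted rs.
Qed.

Lemma reduced_behead a s : reduced (a :: s) -> reduced s.
Proof. exact: path_sorted. Qed.

Lemma red_consE a s : reduced (a :: s) -> red_cons a s = a :: s.
Proof. by case: s => //= c s /andP[/negPf->]. Qed.

Lemma red_consK a s :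
  reduced s -> red_cons (letter_inv a) (red_cons a s) = s.
Proof.
case: s => [_|c s rs] /=; first by rewrite letter_invK eqxx.
case: eqP rs => [->|_ rs]; first exact: red_consE.
by rewrite /= letter_invK eqxx.
Qed.

Lemma red_consVK a s :
  reduced s -> red_cons a (red_cons (letter_inv a) s) = s.
Proof. by move/(red_consK (letter_inv a)); rewrite letter_invK. Qed.

Definition red_cat s t := foldr red_cons t s.

Lemma reduced_cat s t : reduced t -> reduced (red_cat s t).
Proof. by move=> rt; elim: s => //= a s; apply: reduced_cons. Qed.

Lemma red_cat0 s : reduced s -> red_cat s [::] = s.
Proof.
elim: s => //= a s IHs rs; rewrite IHs ?red_consE //.
exact: reduced_behead rs.
Qed.

Lemma red_cat_cons a s t : reduced t ->
  red_cat (red_cons a s) t = red_cons a (red_cat s t).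
Proof.
move=> rt; case: s => [//|c s] /=; case: eqP => [->|//].
by rewrite red_consVK // reduced_cat.
Qed.

Lemma red_catA s t u : reduced u ->
  red_cat s (red_cat t u) = red_cat (red_cat s t) u.
Proof. by move=> ru; elim: s => //= a s ->; rewrite red_cat_cons. Qed.

Definition word_inv s := rev (map letter_inv s).

Lemma reduced_inv s : reduced s -> reduced (word_inv s).
Proof.
rewrite /reduced /word_inv rev_sorted sorted_map => rs.
rewrite (eq_sorted (e' := fun a c => c != letter_inv a)) // => a c /=.
by rewrite letter_invK eq_sym.
Qed.

Lemma word_invV s t : reduced t -> red_cat (word_inv s) (red_cat s t) = t.
Proof.
rewrite /word_inv => rt; elim: s => //= a s IHs.
rewrite rev_cons /red_cat foldr_rcons -/(red_cat _ _) -/(red_cat _ _).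
by rewrite red_consK ?reduced_cat.
Qed.

Lemma word_invK : involutive word_inv.
Proof.
move=> s; rewrite /word_inv map_rev revK -map_comp -[RHS]map_id.
by apply: eq_map => a /=; rewrite letter_invK.
Qed.

Implicit Types u v : freegroup.

Lemma freegroupP u : reduced u. Proof. by case: u. Qed.

Definition fg_one := @FreeGroup [::] isT.
Definition fg_mul u v := FreeGroup (reduced_cat u (freegroupP v)).
Definition fg_inv u := FreeGroup (reduced_inv (freegroupP u)).

Lemma fg_mulA : associative fg_mul.
Proof. by move=> u v w; apply/val_inj/red_catA/freegroupP. Qed.
Lemma fg_mul1 : left_id fg_one fg_mul.
Proof. by move=> u; apply: val_inj. Qed.
Lemma fg_mulr1 : right_id fg_one fg_mul.
Proof. by move=> u; apply/val_inj/red_cat0/freegroupP. Qed.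
Lemma fg_mulV : left_inverse fg_one fg_inv fg_mul.
Proof.
move=> u; apply/val_inj; rewrite /= -[in X in red_cat _ X](red_cat0 (freegroupP u)).
exact: word_invV.
Qed.
Lemma fg_mulVr : right_inverse fg_one fg_inv fg_mul.
Proof.
move=> u; rewrite -[u in fg_mul u _](_ : fg_inv (fg_inv u) = u) ?fg_mulV //.
exact/val_inj/word_invK.
Qed.

HB.instance Definition _ :=
  isGroup.Build freegroup fg_mulA fg_mul1 fg_mulr1 fg_mulV fg_mulVr.

Definition fg_gen (i : I) : freegroup := @FreeGroup [:: (i, false)] isT.

Section Lift.
Variables (G : groupType) (b : I -> G).

Definition letter_eval a : G := if a.2 then (b a.1)^-1 else b a.1.

(* The homomorphism from the free group to [G] that maps b_i to [b i]. *)
Definition fg_lift u : G := \prod_(a <- u) letter_eval a.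

Lemma fg_lift_gen i : fg_lift (fg_gen i) = b i.
Proof. by rewrite /fg_lift big_seq1. Qed.

Lemma fg_liftM : {morph fg_lift : u v / u * v}.
Proof.
have cons a s : \prod_(c <- red_cons a s) letter_eval c =
                letter_eval a * \prod_(c <- s) letter_eval c.
  case: s => [|c s] /=; first by rewrite big_cons.
  case: eqP => [->|_]; last by rewrite big_cons.
  rewrite big_cons mulgA /letter_eval /=; case: a.2 => /=;
  by rewrite ?mulgV ?mulVg mul1g.
case=> [s rs] v; rewrite /fg_lift /= {rs}.
elim: s => [|a s IHs] /=; first by rewrite big_nil mul1g.
by rewrite cons IHs big_cons mulgA.
Qed.

Lemma fg_lift_morphism : monoid.monoid_morphism fg_lift.
Proof. by split; [rewrite /fg_lift big_nil | exact: fg_liftM]. Qed.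

HB.instance Definition _ :=
  isUMagmaMorphism.Build freegroup G fg_lift fg_lift_morphism.

End Lift.

Lemma fg_lift_unique (G : groupType) (f : {multiplicative freegroup -> G}) :
  f =1 fg_lift (f \o fg_gen).
Proof.
have f1 : f 1 = 1 by apply: (@mulgI _ (f 1)); rewrite -gmulfM !mulg1.
have fV u : f u^-1 = (f u)^-1.
  by apply: (@mulgI _ (f u)); rewrite -gmulfM !mulgV.
case=> s; elim: s => [rs|a s IHs ras].
  by rewrite /fg_lift big_nil -f1; congr (f _); apply: val_inj.
have rs := reduced_behead ras; have ra : reduced [:: a] by [].
have -> : FreeGroup ras = FreeGroup ra * FreeGroup rs.
  by apply: val_inj; rewrite /= red_consE.
rewrite fg_liftM gmulfM IHs; congr (_ * _).
rewrite /fg_lift big_seq1 /letter_eval; case: a {ras} ra => i [] ra /=.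
  by rewrite -fV; congr (f _); apply: val_inj.
by congr (f _); apply: val_inj.
Qed.

End FreeGroup.

Section PrimitivityRank.
Variable G : groupType.
Implicit Types (H : G -> Prop) (w : G).

Definition is_subgroup H := H 1 /\ (forall x y, H x -> H y -> H (x * y^-1)).

Definition is_basis H (I : choiceType) (b : I -> G) :=
  injective (fg_lift b) /\ (forall x, H x <-> exists u, fg_lift b u = x).

Definition has_rank H (k : nat) := exists b : 'I_k -> G, is_basis H b.

Definition primitive_in H w :=
  exists (I : choiceType) (b : I -> G), is_basis H b /\ exists i, b i = w.

Definition nonprimitive_rank w (k : nat) :=
  exists H, [/\ is_subgroup H, has_rank H k, H w & ~ primitive_in H w].

(* [None] stands for infinity. *)
Definition primitivity_rank w : option nat :=
  if pselect (exists k, `[< nonprimitive_rank w k >]) is left h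
  then Some (ex_minn h) else None.

End PrimitivityRank.

(* The homomorphisms from F_r to [G] are the maps [fg_lift x] with
   [x : 'I_r -> G] arbitrary. *)
Definition word_expectation (gT : finGroupType) (G : {group gT}) (r : nat)
    (w : freegroup 'I_r) (f : gT -> algC) : algC :=
  let homs : {set {ffun 'I_r -> gT}} := [set x in ffun_on G] in
  ((\sum_(x in homs) f (fg_lift x w)) / #|homs|%:R)%R.

Definition perm_character (aT : finGroupType) (D : {set aT}) (rT : finType)
    (to : action D rT) (S : {set rT}) (g : aT) : algC :=
  (#|'Fix_(S | to)[g]|%:R)%R.

Section Wreath.
Variables (gT : finGroupType) (n : nat).

Let power := {dffun 'I_n -> gT}.

Definition coord_perm (x : power) (s : 'S_n) : power :=
  [ffun i => x (s^-1 i)].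

Lemma coord_perm1 : coord_perm^~ 1 =1 id.
Proof. by move=> x; apply/ffunP => i; rewrite ffunE invg1 perm1. Qed.

Lemma coord_permM : forall x, act_morph coord_perm x.
Proof.
by move=> x s t; apply/ffunP => i; rewrite !ffunE invMg permM.
Qed.

Canonical coord_perm_action := TotalAction coord_perm1 coord_permM.

Lemma coord_perm_is_groupAction : is_groupAction setT coord_perm_action.
Proof.
move=> s _; rewrite /= inE; apply/andP; split.
  by apply/subsetP=> x _; rewrite inE.
apply/morphicP=> x y _ _; rewrite !actpermE.
by apply/ffunP=> i; rewrite !ffunE.
Qed.

Definition wreath := sdprod_by (GroupAction coord_perm_is_groupAction).
HB.instance Definition _ := FinGroup.on wreath.

End Wreath.

(* Only the values n 1, ..., n m matter. *)
Fixpoint iterated_wreath (gT : finGroupType) (n : nat -> nat) (m : nat) :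
    finGroupType :=
  if m is k.+1 then wreath (iterated_wreath gT n k) (n k.+1) else gT.

Fixpoint vertex (n : nat -> nat) (m : nat) : finType :=
  if m is k.+1 then option ('I_(n k.+1) * vertex n k)%type else unit.

Definition tree_root (n : nat -> nat) (m : nat) : vertex n m :=
  if m is _.+1 then None else tt.

(* [is_child u v]: v is a child of u. *)
Fixpoint is_child (n : nat -> nat) (m : nat) : rel (vertex n m) :=
  if m is k.+1 then fun u v =>
    match u, v with
    | None, Some (_, v') => v' == tree_root n k
    | Some (i, u'), Some (j, v') => (i == j) && is_child u' v'
    | _, None => false
    end
  else fun _ _ => false.

Section Tree.
Variables (n : nat -> nat) (m : nat).

Definition leaves : {set vertex n m} :=
  [set v | [forall u, ~~ is_child v u]].

Definition tree_aut : {set {perm vertex n m}} :=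
  [set s : {perm vertex n m} | (s (tree_root n m) == tree_root n m) &&
           [forall u, forall v, is_child (s u) (s v) == is_child u v]].

Lemma tree_autP (s : {perm vertex n m}) :
  reflect (s (tree_root n m) = tree_root n m /\
           forall u v, is_child (s u) (s v) = is_child u v)
          (s \in tree_aut).
Proof.
rewrite inE; apply: (iffP andP) => [[/eqP sr /forallP sc]|[-> sc]].
  by split=> // u v; apply/eqP; have /forallP := sc u; apply.
by split=> //; apply/forallP=> u; apply/forallP=> v; rewrite sc.
Qed.

Lemma tree_aut_group_set : group_set tree_aut.
Proof.
apply/group_setP; split=> [|s t /tree_autP[sr sc] /tree_autP[tr tc]].
  by apply/tree_autP; split=> [|u v]; rewrite !perm1.
by apply/tree_autP; split=> [|u v]; rewrite !permM ?sr // tc sc.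
Qed.

Lemma tree_ind (P : vertex n m -> Prop) :
  P (tree_root n m) -> (forall u v, is_child u v -> P u -> P v) ->
  forall v, P v.
Proof.
elim: m P => [P Pr _ []//|k IHk P Pr Pc [[i u]|]] //.
apply: (IHk (fun u => P (Some (i, u)))) => [|u' v c]; last first.
  by apply: Pc; rewrite /= eqxx.
by apply: (Pc _ _ _ Pr) => /=.
Qed.

Canonical tree_aut_group := Group tree_aut_group_set.

End Tree.

(* Aut(T) is the iterated wreath product over the trivial group ['I_1]. *)
Section TreeWreath.
Variables (n : nat -> nat) (k : nat).
Let V := vertex n k.
Variables (gT : finGroupType) (f : {morphism [set: gT] >-> {perm V}}).
Local Notation W := (wreath gT (n k.+1)).

Lemma morph_all x y : f (x * y) = f x * f y.
Proof. by rewrite morphM ?inE. Qed.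

(* The element [(s, x)] of the wreath product first permutes the subtrees by
   [s], then acts by [x j] on the [j]-th one. *)
Definition wreath_fun (p : W) (v : vertex n k.+1) : vertex n k.+1 :=
  if v is Some (i, u) then Some (p.1 i, f (p.2 (p.1 i)) u) else None.

Lemma wreath_fun_inj p : injective (wreath_fun p).
Proof.
case=> [[i u]|] [[j v]|] //= [/perm_inj eij].
by rewrite {}eij => /perm_inj->.
Qed.

Definition wreath_perm p : {perm vertex n k.+1} := perm (@wreath_fun_inj p).

Lemma wreath_permE p v : wreath_perm p v = wreath_fun p v.
Proof. exact: permE. Qed.

Lemma wreath_permM : {in setT &, {morph wreath_perm : p q / p * q}}.
Proof.
move=> p q _ _; apply/permP => -[[i u]|]; rewrite permM !wreath_permE //=.
by rewrite !ffunE /= !permM permK morph_all permM.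
Qed.

Canonical wreath_perm_morphism := Morphism wreath_permM.

Hypothesis f_inj : 'injm f.
Hypothesis f_im : f @* setT = tree_aut n k.

Lemma wreath_perm_injm : 'injm wreath_perm.
Proof.
apply/injmP => p q _ _ /permP epq.
have eq1 : p.1 = q.1.
  apply/permP => i; move: (epq (Some (i, tree_root n k))).
  by rewrite !wreath_permE /= => -[].
have eq2 : p.2 = q.2.
  apply/ffunP => j; apply: (injmP f_inj); rewrite ?inE //.
  apply/permP => u; move: (epq (Some (p.1^-1 j, u))).
  by rewrite !wreath_permE /= -eq1 permKV => -[].
apply: val_inj => /=; move: eq1 eq2.
by case: (p : _ * _) => ? ?; case: (q : _ * _) => ? ? /= -> ->.
Qed.

Lemma wreath_perm_im : wreath_perm @* setT = tree_aut n k.+1.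
Proof.
apply/setP => s; apply/morphimP/tree_autP => [[p _ _ ->]|[sr sc]].
  have fa j : f (p.2 j) \in tree_aut n k by rewrite -f_im mem_morphim ?inE.
  split=> [|[[i u]|] [[j v]|]]; rewrite !wreath_permE //=.
    rewrite (inj_eq perm_inj); case: eqP => //= ->.
    by have /tree_autP[_ ->] := fa (p.1 j).
  by have /tree_autP[fr _] := fa (p.1 j); rewrite -[in LHS]fr (inj_eq perm_inj).
pose idx i := if s (Some (i, tree_root n k)) is Some (j, _) then j else i.
have sroot i : s (Some (i, tree_root n k)) = Some (idx i, tree_root n k).
  have := sc None (Some (i, tree_root n k)); rewrite sr /= eqxx /idx.
  by case: (s _) => [[j v]|] //= /eqP->.
pose sub i u := if s (Some (i, u)) is Some (_, u') then u' else u.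
have sE i u : s (Some (i, u)) = Some (idx i, sub i u).
  elim/tree_ind: u => [|u v cuv su]; first by rewrite /sub sroot.
  have := sc (Some (i, u)) (Some (i, v)); rewrite su /= eqxx cuv /= /sub.
  by case: (s (Some (i, v))) => [[j v']|] //= /andP[/eqP->].
have idx_inj : injective idx.
  move=> i j eij; have := sroot i; rewrite eij -sroot => /perm_inj.
  by case.
have sub_inj i : injective (sub i).
  by move=> u v euv; have := sE i u; rewrite euv -sE => /perm_inj[].
pose t := perm idx_inj.
have sub_aut i : perm (@sub_inj i) \in f @* setT.
  rewrite f_im; apply/tree_autP; split=> [|u v]; rewrite !permE.
    by have := sE i (tree_root n k); rewrite sroot => -[].
  have := sc (Some (i, u)) (Some (i, v)).
  by rewrite !sE /= !eqxx.
pose x : {dffun 'I_(n k.+1) -> gT} :=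
  [ffun j => invm f_inj (perm (@sub_inj (t^-1 j)))].
have tx : (t, x) \in setX setT setT by rewrite !inE.
exists (SdPair _ tx); rewrite ?inE //; apply/permP => -[[i u]|].
  rewrite wreath_permE sE /= ffunE permK invmK ?sub_aut // !permE.
  by [].
by rewrite wreath_permE.
Qed.

End TreeWreath.

Lemma tree_aut_wreath (n : nat -> nat) (m : nat) :
  tree_aut n m \isog [set: iterated_wreath 'I_1 n m].
Proof.
elim: m => [|k].
  have e1 : tree_aut_group n 0 = 1%G.
    apply/val_inj/setP=> s /=; rewrite !inE; apply/andP/eqP => [_|->].
      by apply/permP => -[]; case: (s tt); rewrite perm1.
    by rewrite perm1; split=> //; apply/forallP=> u; apply/forallP.
  have e2 : [set: iterated_wreath 'I_1 n 0]%G = 1%G.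
    by apply/val_inj/setP => i /=; rewrite !inE ord1.
  rewrite -[tree_aut n 0]/(gval (tree_aut_group n 0)) e1.
  rewrite -[[set: _]]/(gval [set: iterated_wreath 'I_1 n 0]%G) e2.
  by rewrite isog_cyclic_card ?cyclic1 // !cards1.
rewrite isog_sym => /isogP[f f_inj f_im]; rewrite isog_sym.
apply/isogP; exists (wreath_perm_morphism f); last exact: wreath_perm_im.
exact: wreath_perm_injm.
Qed.

(* x ^ (1 - p), which is 0 for p infinite. *)
Definition pow_1_sub (x : algC) (p : option nat) : algC :=
  (if p is Some k then x ^ (1 - k%:Z) else 0)%R.

(* Main.v *)
Require Import Defs.
From HB Require Import structures.
From mathcomp Require Import all_boot all_order all_fingroup all_algebra.
From mathcomp Require Import all_solvable all_field.
From mathcomp Require Import boolp zify ring.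
Set Implicit Arguments.
Unset Strict Implicit.
Unset Printing Implicit Defensive.

Import Order.TTheory GRing.Theory Num.Theory.

Local Open Scope ring_scope.

(** Let l be the length of w.  Follow a point along w under a tuple of
    permutations: it visits a vertex at each of the positions 0, ..., l, and
    identifying the positions that visit the same vertex gives a graph on
    which w is a path.  This graph is folded (an edge is determined by its
    generator and either end), and the point is fixed exactly when the path
    is closed.  There are finitely many such core graphs; they do not depend
    on the groups, and they are encoded here as partitions of the positions.

    Put independent uniform elements of a group on the edges of a core graph
    g, and read w along its loop in g.  For a wreath product G wr S_n this is
    a random n-sheeted cover of g with labels in G, and sorting the fixed
    points by the core graph d of the lifted path gives [wreath_formula]: the
    expectation is the sum over the refinements d of g of the expected number
    of lifts of d to the cover, which is of order n^(V(d)-E(d)), times the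
    expectation over G for the graph d.  One level of the tree is one wreath
    product, and the constant character on G gives the natural character of
    S_n.  So the difference to be bounded is the sum over d of the number of
    lifts times E_d - 1, where E_d is the expectation for d over the tree
    with one level less.

    The fundamental group of d is free of rank E(d)-V(d)+1 and embeds into
    F_r with w in the image.  If w is primitive there, its value in a finite
    group is uniformly distributed, and E_d is the average number of fixed
    leaves, which is 1.  If not, E(d)-V(d)+1 is at least pi(w) by definition,
    and d contributes a factor O(n^(1-pi(w))).  This is [primitive_or_rank].

    It remains to bound E_d - 1 itself, and by induction on the levels this
    reduces to symmetric groups, that is, to [lift_sum_near1].  The number of
    lifts of d to a cover of g is n^(V(d)-E(d)) times a product over vertices
    and edges that expands into a sum over ways of merging vertices or edges
    of d lying over the same vertex or edge of g, where every merge costs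
    a factor O(1/n).  A set of merges is compatible with g exactly when the
    finest folded quotient h of d that performs them refines g.  Grouping by
    h writes the expectation for g as a sum of coefficients R_h(n) over the
    refinements h of g, with R_h independent of g.  A merge raises the rank by
    at most one ([rank_fold_closure]), so R_h(n) = O(n^(V(h)-E(h))), which is
    O(n^(1-pi(w))) when w is not primitive in h.  When w is primitive in h,
    the sum over all refinements of h is 1; the finest core graph already
    contributes 1 (its rank is at most one), so R_h is minus the sum of the
    remaining coefficients, and induction along refinement applies
    ([merge_coef_small]).

    The word 1 has primitivity rank 0, and for two levels the bound is then
    the number of leaves. *)

(** * Uniform means and counting of permutations and injections *)

Definition mean (T : finType) (F : T -> algC) : algC :=
  (\sum_x F x) / #|T|%:R.

Lemma eq_mean (T : finType) (F F' : T -> algC) : F =1 F' -> mean F = mean F'.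
Proof. by move=> eF; rewrite /mean (eq_bigr F'). Qed.

Lemma mean_bij (T T' : finType) (h : T -> T') (F : T' -> algC) :
  bijective h -> mean (fun x => F (h x)) = mean F.
Proof.
move=> bh; rewrite /mean (bij_eq_card bh); congr (_ / _).
by rewrite [RHS](reindex h) //; apply: onW_bij.
Qed.

Lemma mean_const (T : finType) (c : algC) : (0 < #|T|)%N -> mean (fun _ : T => c) = c.
Proof.
move=> T0; rewrite /mean sumr_const -[c *+ _]mulr_natr mulfK //.
by rewrite pnatr_eq0 -lt0n.
Qed.

Section MeanReindex.
Variable G : finGroupType.

(** Restriction of coordinates is a group morphism G^U -> G^K, so that its
    fibres all have the same size. *)
Lemma mean_ffun_inj (K U : finType) (i : K -> U) (F : {ffun K -> G} -> algC) :
  injective i ->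
  mean (fun x : {ffun U -> G} => F [ffun k => x (i k)]) = mean F.
Proof.
move=> inj_i.
pose res (x : {ffun U -> G}) : {ffun K -> G} := [ffun k => x (i k)].
pose N := #|[set x | res x == [ffun=> 1%g]]|.
have fib z : #|[set x | res x == z]| = N.
  have [e eE] : exists e : {ffun U -> G}, forall k, e (i k) = z k.
    exists [ffun u => if [pick k | i k == u] is Some k then z k else 1%g] => k.
    by rewrite ffunE; case: pickP => [k' /eqP/inj_i->|/(_ k)] //; rewrite eqxx.
  pose t (x : {ffun U -> G}) : {ffun U -> G} := [ffun u => (x u * e u)%g].
  have t_inj : injective t.
    move=> x y /ffunP exy; apply/ffunP=> u; have := exy u.
    by rewrite !ffunE => /mulIg.
  rewrite /N -[RHS](card_imset _ t_inj); apply: eq_card => x; rewrite !inE.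
  apply/idP/imsetP => [/eqP rx|[y]]; last first.
    rewrite inE => /eqP ry ->; apply/eqP/ffunP=> k; rewrite !ffunE eE.
    by have /ffunP/(_ k) := ry; rewrite !ffunE => ->; rewrite mul1g.
  exists [ffun u => (x u * (e u)^-1)%g].
    rewrite inE; apply/eqP/ffunP=> k; rewrite !ffunE eE.
    by have /ffunP/(_ k) := rx; rewrite !ffunE => ->; rewrite mulgV.
  by apply/ffunP=> u; rewrite !ffunE mulgKV.
have sumE (F' : {ffun K -> G} -> algC) :
    \sum_x F' (res x) = N%:R * \sum_z F' z.
  rewrite (partition_big res predT) //= mulr_sumr; apply: eq_bigr => z _.
  rewrite -(fib z) (eq_bigr (fun=> F' z)) => [|x /eqP-> //].
  by rewrite sumr_const mulr_natl; congr (_ *+ _); apply: eq_card => x; rewrite inE.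
have cardE := sumE (fun=> 1); rewrite !sumr_const in cardE.
have cG (T : finType) : #|{ffun T -> G}|%:R != 0 :> algC.
  by rewrite pnatr_eq0 -lt0n; apply/card_gt0P; exists [ffun=> 1%g].
have := cG U; rewrite cardE mulf_eq0 negb_or => /andP[N0 _].
by rewrite /mean sumE cardE -mulf_div divff ?mul1r.
Qed.

(** Both sides are means over one independent element per class of the common
    kernel of [u] and [u']. *)
Lemma mean_kernel (J U U' : finType) (u : J -> U) (u' : J -> U')
    (F : {ffun J -> G} -> algC) :
  (forall j k, (u j == u k) = (u' j == u' k)) ->
  mean (fun x : {ffun U -> G} => F [ffun j => x (u j)]) =
  mean (fun x : {ffun U' -> G} => F [ffun j => x (u' j)]).
Proof.
move=> uu'.
pose c j := odflt j [pick k | u k == u j].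
have uc j : u (c j) = u j.
  by rewrite /c; case: pickP => [k /eqP//|].
have u'c j : u' (c j) = u' j by apply/eqP; rewrite -uu' uc.
have cu j k : u j = u k -> c j = c k.
  move=> ujk; rewrite /c (eq_pick (Q := fun i => u i == u k)); last by move=> i; rewrite /= ujk.
  by case: pickP => // /(_ k); rewrite eqxx.
pose K := {j | c j == j}.
have cP j : c (c j) == c j by apply/eqP/cu/uc.
pose d j : K := exist _ (c j) (cP j).
have key (V : finType) (v : J -> V) : (forall j, v (c j) = v j) ->
    (forall j k, v j = v k -> c j = c k) ->
    mean (fun x : {ffun V -> G} => F [ffun j => x (v j)]) =
    mean (fun z : {ffun K -> G} => F [ffun j => z (d j)]).
  move=> vc cv; have vi : injective (fun k : K => v (val k)).
    move=> [j /= ej] [k /= ek] /cv e; apply: val_inj => /=.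
    by rewrite -(eqP ej) -(eqP ek).
  rewrite -(mean_ffun_inj (fun z => F [ffun j => z (d j)]) vi).
  by apply: eq_mean => x; congr F; apply/ffunP=> j; rewrite !ffunE /= vc.
rewrite !key // => j k /eqP; rewrite -uu' => /eqP; exact: cu.
Qed.

End MeanReindex.

Section Counting.

(** The permutation is built by adding the points of [D] one at a time,
    correcting each time by one transposition. *)
Lemma perm_extend (T : finType) (D : {set T}) (f : T -> T) :
  {in D &, injective f} -> exists s : {perm T}, {in D, s =1 f}.
Proof.
move: {2}#|D| (leqnn #|D|) => k; elim: k => [|k IHk] in D *.
  by rewrite leqn0 cards_eq0 => /eqP-> _; exists 1%g => x; rewrite inE.
have [->|[x xD]] := set_0Vmem D; first by move=> _ _; exists 1%g => x; rewrite inE.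
rewrite (cardsD1 x) xD ltnS => kD fD.
have [|s sf] := IHk _ kD.
  by move=> y z; rewrite !inE => /andP[_ yD] /andP[_ zD]; apply: fD.
exists (s * tperm (s x) (f x))%g => y yD; rewrite permM.
have [->|yx] := eqVneq y x; first by rewrite tpermL.
have sy : s y = f y by apply: sf; rewrite !inE yx.
rewrite tpermD // ?(inj_eq perm_inj) 1?eq_sym //.
by rewrite sy; apply: contra_neq yx; apply: fD.
Qed.

(** Dividing by one extension leaves the permutations that fix [D] pointwise. *)
Lemma card_perm_extend (T : finType) (D : {set T}) (f : T -> T) :
  {in D &, injective f} ->
  #|[set s : {perm T} | [forall x in D, s x == f x]]| = (#|T| - #|D|)`!.
Proof.
move=> /perm_extend[s0 s0f].
have -> : (#|T| - #|D|)%N = #|~: D| by rewrite [RHS]cardsCs setCK.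
rewrite -card_perm -[RHS](card_imset _ (mulIg s0)).
apply: eq_card => s; rewrite inE; apply/forall_inP/imsetP => [sf|[t tD ->] x xD].
  exists (s * s0^-1)%g; last by rewrite mulgKV.
  rewrite unfold_in; apply/subsetP => x; rewrite !inE permM; apply: contra => xD.
  by rewrite (eqP (sf x xD)) -s0f // permK.
rewrite permM (out_perm tD) ?inE ?xD ?s0f //.
Qed.

Variables (A B : finType).
Implicit Types (S : {set A}) (f : A -> B).

(** The number of these elements is the number of values that are no longer
    free when distinct values are given to the points of a fibre in turn. *)
Definition prec S f a :=
  [set b in S | (enum_rank b < enum_rank a)%N && (f b == f a)].

Lemma last_elt S : S != set0 ->
  exists2 a, a \in S & forall b, b \in S -> (enum_rank b <= enum_rank a)%N.
Proof.
case/set0Pn=> a0 a0S; case: (arg_maxnP (fun a => nat_of_ord (enum_rank a)) a0S).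
by move=> a aS ha; exists a.
Qed.

Lemma last_ind_set (P : {set A} -> Prop) : P set0 ->
  (forall S a, a \notin S -> (forall b, b \in S -> (enum_rank b < enum_rank a)%N) ->
     P S -> P (a |: S)) -> forall S, P S.
Proof.
move=> P0 PS S; move: {2}#|S| (leqnn #|S|) => k; elim: k => [|k IHk] in S *.
  by rewrite leqn0 cards_eq0 => /eqP->.
have [-> //|/last_elt[a aS ha]] := eqVneq S set0.
rewrite (cardsD1 a) aS ltnS => kS; rewrite -(setD1K aS).
apply: PS => [|b|]; rewrite ?inE ?eqxx //; last exact: IHk.
case/andP=> ba bS; rewrite ltn_neqAle ha // andbT.
by apply: contra_neq ba => /ord_inj/enum_rank_inj.
Qed.

Lemma prec_last S f a b : b \in S -> (forall b, b \in S -> (enum_rank b < enum_rank a)%N) ->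
  prec (a |: S) f b = prec S f b.
Proof.
move=> bS ha; apply/setP=> c; rewrite !inE; have [->|] //= := eqVneq c a.
by rewrite ltnNge ltnW ?ha //= andbF.
Qed.

Lemma prec_at_last S f a : (forall b, b \in S -> (enum_rank b < enum_rank a)%N) ->
  prec (a |: S) f a = [set b in S | f b == f a].
Proof.
move=> ha; apply/setP=> c; rewrite !inE; have [->|_] := eqVneq c a.
  by rewrite ltnn /=; case: (boolP (a \in S)) => // /ha; rewrite ltnn.
by case: (boolP (c \in S)) => //= /ha->.
Qed.

(** A falling factorial for each fibre, written point by point: this form
    lets a fibre be split differently by different maps [f]. *)
Lemma prod_ffact S f n :
  (\prod_b n ^_ #|[set a in S | f a == b]| = \prod_(a in S) (n - #|prec S f a|))%N.
Proof.
elim/last_ind_set: S => [|S a aS ha IH].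
  rewrite big_set0 big1 // => b _; rewrite (_ : [set _ in _ | _] = set0) ?cards0 //.
  by apply/setP=> a; rewrite !inE.
rewrite (big_setU1 _ aS) /= prec_at_last //.
rewrite (eq_bigr (fun c => (n - #|prec S f c|)%N)) => [|c cS]; last by rewrite prec_last.
rewrite -IH (bigD1 (f a)) //= [in RHS](bigD1 (f a)) //= mulnA; congr (_ * _)%N.
  rewrite mulnC -ffactnSr; congr (_ ^_ _).
  rewrite (_ : [set _ in _ |: _ | _] = a |: [set b in S | f b == f a]).
    by rewrite cardsU1 !inE (negPf aS).
  by apply/setP=> b; rewrite !inE; have [->|] := eqVneq b a; rewrite ?eqxx.
apply: eq_bigr => b ba; congr (_ ^_ _); apply: eq_card => c; rewrite !inE.
by have [->|] //= := eqVneq c a; rewrite eq_sym (negPf ba) andbF.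
Qed.

(** Values outside [S] are frozen to [t0] so that the count is over functions
    on [S].  Adding a last point to [S] multiplies the count by the number of
    values not taken yet by its fibre. *)
Lemma card_fiber_inj (T : finType) (t0 : T) S f :
  #|[set h : {ffun A -> T} | (h \in pffun_on t0 (mem S) predT) &&
      [forall a in S, forall b in S, (f a == f b) ==> (h a == h b) ==> (a == b)]]| =
  (\prod_(a in S) (#|T| - #|prec S f a|))%N.
Proof.
elim/last_ind_set: S => [|S a aS ha IH].
  rewrite big_set0 -[RHS](cards1 ([ffun=> t0] : {ffun A -> T})).
  apply: eq_card => h; rewrite !inE; apply/andP/eqP => [[/pffun_onP[hs _] _]|->].
    apply/ffunP=> b; rewrite ffunE; apply/eqP; apply: contraT => hb.
    have : b \in t0.-support h by rewrite inE.
    by move/(subsetP hs); rewrite inE.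
  split; last by apply/forall_inP=> b; rewrite inE.
  apply/pffun_onP; split=> //; apply/subsetP=> b; rewrite inE ffunE eqxx //.
rewrite (big_setU1 _ aS) /= prec_at_last //.
rewrite (eq_bigr (fun c => (#|T| - #|prec S f c|)%N)) => [|c cS]; last by rewrite prec_last.
rewrite -IH.
pose V S' := [set h : {ffun A -> T} | (h \in pffun_on t0 (mem S') predT) &&
      [forall a in S', forall b in S', (f a == f b) ==> (h a == h b) ==> (a == b)]].
rewrite -/(V (a |: S)) -/(V S).
have VP S' (h : {ffun A -> T}) : reflect ((forall c, c \notin S' -> h c = t0) /\
    (forall c d, c \in S' -> d \in S' -> f c = f d -> h c = h d -> c = d)) (h \in V S').
  rewrite inE; apply: (iffP andP) => [[/pffun_onP[hs _] hi]|[hs hi]]; split.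
  - move=> c cS; apply/eqP; apply: contraT => hc; case/negP: cS.
    by apply: (subsetP hs); rewrite inE.
  - move=> c d cS dS e1 e2; have /forall_inP/(_ c cS)/forall_inP/(_ d dS) := hi.
    by rewrite e1 e2 !eqxx => /eqP.
  - apply/pffun_onP; split=> //; apply/subsetP=> c; rewrite inE; apply: contraR.
    by move/hs->.
  - apply/forall_inP=> c cS; apply/forall_inP=> d dS; apply/implyP=> /eqP e1.
    by apply/implyP=> /eqP e2; apply/eqP/hi.
pose upd (h : {ffun A -> T}) t : {ffun A -> T} := [ffun c => if c == a then t else h c].
pose D (h : {ffun A -> T}) := h @: [set b in S | f b == f a].
have DE h : h \in V S -> #|D h| = #|[set b in S | f b == f a]|.
  case/VP=> _ hi; apply: card_in_imset => c d; rewrite !inE.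
  by move=> /andP[cS /eqP fc] /andP[dS /eqP fd]; apply: hi; rewrite ?fc.
transitivity (\sum_(h in V S) #|~: D h|)%N; last first.
  rewrite (eq_bigr (fun=> #|T| - #|[set b in S | f b == f a]|)%N) => [|h hV].
    by rewrite sum_nat_const mulnC.
  by rewrite cardsCs setCK DE.
rewrite -sum1_card (partition_big (fun h => upd h t0) (mem (V S))) /=; last first.
  move=> h /VP[hs hi]; apply/VP; split=> c.
    move=> cS; rewrite ffunE; case: eqP => // /eqP ca; apply: hs.
    by rewrite !inE negb_or ca.
  move=> d cS dS; rewrite !ffunE; case: eqP cS => [->|_ cS]; first by rewrite (negPf aS).
  case: eqP dS => [->|_ dS]; first by rewrite (negPf aS).
  by apply: hi; rewrite inE ?cS ?dS orbT.
apply: eq_bigr => h hV; have [hs hi] := VP _ _ hV.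
rewrite sum1dep_card -(card_imset (mem (~: D h)) (f := upd h)); last first.
  by move=> t t' /ffunP/(_ a); rewrite !ffunE eqxx.
apply: eq_card => g; rewrite inE; apply/andP/imsetP => [[/VP[gs gi] /eqP gh]|[t tD ->]].
  exists (g a).
    rewrite !inE; apply/imsetP => -[b]; rewrite inE => /andP[bS /eqP fb] gab.
    have ba : b != a by apply: contraNneq aS => <-.
    have gb : g b = h b by rewrite -gh ffunE (negPf ba).
    case/eqP: ba; apply: gi; rewrite ?inE ?bS ?eqxx ?orbT // gb; exact/esym.
  by apply/ffunP=> c; rewrite ffunE -gh ffunE; case: eqP => // ->.
have hN c d : c != a -> c \in a |: S -> (c == a) = false /\ c \in S.
  by move=> ca; rewrite !inE (negPf ca).
split; last first.
  apply/eqP/ffunP=> c; rewrite !ffunE; case: eqP => // ->.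
  by rewrite hs.
apply/VP; split=> [c|c d].
  by rewrite !inE negb_or => /andP[ca cS]; rewrite ffunE (negPf ca) hs.
rewrite !inE !ffunE.
have tN b : b \in S -> f b = f a -> h b != t.
  move=> bS fb; apply: contraTneq tD => <-; rewrite inE negbK.
  by apply/imsetP; exists b; rewrite // inE bS fb eqxx.
case: (eqVneq c a) => [->|ca] /=; case: (eqVneq d a) => [->|da] //=.
- by move=> _ dS fd td; have := tN d dS (esym fd); rewrite -td eqxx.
- by move=> cS _ fc ct; have := tN c cS fc; rewrite ct eqxx.
- exact: hi.
Qed.

End Counting.

(** * Expansion of falling products into merges *)

Section Expansion.
Variables (A B : finType).
Implicit Types (S : {set A}) (f : A -> B) (F : {ffun A -> {set A}}).

Definition earlier S a :=
  if a \in S then [set b in S | (enum_rank b < enum_rank a)%N] else set0.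

Definition admissible S F := [forall a, F a \subset earlier S a].

Definition respects f F := [forall a, forall b in F a, f b == f a].

(** Expanding the product chooses a set [F a] of earlier points for each [a].
    Only the condition [respects f F] depends on [f]: the weights do not.
    This is what makes the coefficients in the final regrouping independent
    of the base graph. *)
Lemma expand_prec S f (mu : nat -> algC) : mu 0 = 1 ->
  \prod_(a in S) (\sum_(X : {set A} | X \subset prec S f a) mu #|X|) =
  \sum_(F | admissible S F && respects f F) \prod_a mu #|F a|.
Proof.
move=> mu0.
pose D a := if a \in S then prec S f a else set0.
have -> : \prod_(a in S) (\sum_(X : {set A} | X \subset prec S f a) mu #|X|) =
    \prod_a (\sum_(X : {set A} | X \subset D a) mu #|X|).
  rewrite [RHS](bigID (mem S)) /= [X in _ * X]big1 ?mulr1 => [|a aS].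
    by apply: eq_bigr => a aS; rewrite /D aS.
  rewrite /D (negPf aS) (big_pred1 set0) ?cards0 // => X.
  by rewrite /= subset0.
rewrite bigA_distr_big_dep; apply: eq_bigl => F.
apply/familyP/andP => [FD|[/forallP Fa /forallP Ff] a].
  split; apply/forallP=> a; have : F a \subset D a := FD a; rewrite /D /earlier; case: ifP => aS.
  - move/subset_trans; apply; apply/subsetP=> b; rewrite !inE.
    by case/and3P=> -> ->.
  - by [].
  - move/subsetP=> h; apply/forall_inP=> b /h; rewrite !inE.
    by case/and3P.
  - by rewrite subset0 => /eqP->; apply/forall_inP=> b; rewrite inE.
have := Fa a; rewrite /earlier => h; change (F a \subset D a); rewrite /D.
move: h; case: ifP => // aS /subsetP h.
apply/subsetP=> b bF; have := h b bF; rewrite !inE => /andP[-> ->] /=.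
by have /forall_inP := Ff a; apply.
Qed.

Lemma sum_subset_card (D : {set A}) (mu : nat -> algC) :
  \sum_(X : {set A} | X \subset D) mu #|X| =
  \sum_(s < #|D|.+1) 'C(#|D|, s)%:R * mu s.
Proof.
have lt (X : {set A}) : X \subset D -> (#|X| < #|D|.+1)%N by move/subset_leq_card.
rewrite (partition_big (fun X : {set A} => inord #|X| : 'I_#|D|.+1) predT) //=.
apply: eq_bigr => s _; rewrite -cards_draws mulr_natl.
rewrite (eq_bigl (mem [set X : {set A} | X \subset D & #|X| == s])) => [|X].
  rewrite (eq_bigr (fun=> mu s)) ?sumr_const // => X.
  by rewrite /= inE => /andP[_ /eqP->].
rewrite !inE; case: (boolP (X \subset D)) => //= /lt XD.
by rewrite -val_eqE /= inordK.
Qed.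

End Expansion.

(** Chosen so that summing over the subsets of a set of [k] points gives
    1 - k/n: at most one earlier point is chosen, at a cost of -1/n. *)
Definition vweight (n s : nat) : algC :=
  if s is s'.+1 then (if s' is _.+1 then 0 else - n%:R^-1) else 1.

Lemma sum_vweight n k : (0 < n)%N ->
  \sum_(s < k.+1) 'C(k, s)%:R * vweight n s = (n%:R - k%:R) / n%:R.
Proof.
move=> n0; have n0' : n%:R != 0 :> algC by rewrite pnatr_eq0 -lt0n.
rewrite mulrBl divff //; case: k => [|k].
  by rewrite big_ord1 bin0 mul1r mul0r subr0.
rewrite big_ord_recl bin0 mul1r big_ord_recl bin1 big1 ?addr0 /=.
  by rewrite mulrN.
by move=> i _; rewrite mulr0.
Qed.

(** Chosen so that summing over the subsets of a set of [k] points gives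
    1/(1 - k/n): these are the finite differences at 0 of x |-> n/(n - x). *)
Definition eweight (n s : nat) : algC := s`!%:R / (n.-1 ^_ s)%:R.

(** Splitting off the first term gives A(k, N) = 1 + k/N A(k-1, N-1). *)
Lemma sum_ffact_ratio k N : (k <= N)%N ->
  \sum_(s < k.+1) (k ^_ s)%:R / (N ^_ s)%:R = N.+1%:R / (N.+1 - k)%:R :> algC.
Proof.
elim: k N => [|k IHk] [|N] // kN.
- by rewrite big_ord1 !ffactn0 divff // oner_eq0.
- by rewrite big_ord1 !ffactn0 subn0 !divff // pnatr_eq0.
rewrite big_ord_recl !ffactn0 divr1.
rewrite (eq_bigr (fun s : 'I_k.+1 =>
    k.+1%:R / N.+1%:R * ((k ^_ s)%:R / (N ^_ s)%:R))) => [|s _].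
  rewrite -mulr_sumr IHk // mulrA mulfVK ?pnatr_eq0 // subSS.
  have h : (N.+1 - k)%:R != 0 :> algC by rewrite pnatr_eq0 -lt0n subn_gt0.
  apply: (mulIf h); rewrite mulrDl mul1r !divfK // -natrD; congr _%:R.
  by rewrite ltnS in kN; lia.
by rewrite !ffactSS !natrM invfM; ring.
Qed.

Lemma sum_eweight n k : (k < n)%N ->
  \sum_(s < k.+1) 'C(k, s)%:R * eweight n s = n%:R / (n - k)%:R.
Proof.
case: n => // n kn; rewrite -sum_ffact_ratio //; apply: eq_bigr => s _.
by rewrite /eweight mulrA -natrM bin_ffact.
Qed.

(** A common bound for the numerators of both weights; its form comes from
    (N+1)^s <= (s+1)! N(N-1)...(N-s+1). *)
Definition wbound (s : nat) : nat := s`! * s.+1`!.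

Lemma vweight_bound n s : (0 < n)%N -> `|vweight n s| <= (wbound s)%:R / n%:R ^+ s.
Proof.
move=> n0; case: s => [|[|s]] /=.
- by rewrite normr1 expr0 divr1 ler1n.
- by rewrite normrN normfV normr_nat expr1 ler_peMl ?invr_ge0 ?ler0n // ler1n.
- by rewrite normr0 divr_ge0 ?exprn_ge0 ?ler0n.
Qed.

Lemma ffact_lower N s : (s <= N)%N -> (N.+1 ^ s <= s.+1`! * N ^_ s)%N.
Proof.
elim: s => [|s IHs] sN; first by rewrite ffactn0.
rewrite expnSr ffactnSr [s.+2`!]factS.
have := IHs (ltnW sN); have : (N.+1 <= s.+2 * (N - s))%N by nia.
move=> h1 h2; apply: leq_trans (leq_mul h2 h1) _.
by rewrite leq_eqVlt; apply/orP; left; apply/eqP; ring.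
Qed.

Lemma eweight_bound n s : (0 < n)%N -> `|eweight n s| <= (wbound s)%:R / n%:R ^+ s.
Proof.
case: n => // n _; rewrite /eweight /=.
have [sn|sn] := leqP s n; last first.
  by rewrite ffact_small // invr0 mulr0 normr0 divr_ge0 ?exprn_ge0 ?ler0n.
have f0 : 0 < (n ^_ s)%:R :> algC by rewrite ltr0n ffact_gt0.
rewrite ger0_norm ?divr_ge0 ?ler0n // ler_pdivrMr //.
rewrite -mulrA [_^-1 * _]mulrC mulrA ler_pdivlMr ?exprn_gt0 ?ltr0n //.
rewrite -natrX -!natrM ler_nat /wbound -mulnA leq_mul2l.
by rewrite ffact_lower ?orbT.
Qed.

Lemma prod_weight_bound (A : finType) (c : nat -> nat -> algC) (F : {ffun A -> {set A}}) n :
  (forall s, `|c n s| <= (wbound s)%:R / n%:R ^+ s) ->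
  `|\prod_a c n #|F a| | <=
    (\prod_a wbound #|F a|)%N%:R / n%:R ^+ (\sum_a #|F a|).
Proof.
move=> hc; rewrite normr_prod natr_prod.
have -> : n%:R ^+ (\sum_a #|F a|) = \prod_a (n%:R ^+ #|F a|) :> algC.
  by rewrite -prodrXr.
by rewrite -prodf_div; apply: ler_prod => a _; rewrite normr_ge0 hc.
Qed.

(** * Core graphs as partitions of the positions of a word *)

Section Partitions.
Variables (r : nat) (w : seq ('I_r * bool)).
Notation l := (size w).
Notation P := 'I_l.+1.
Notation U := ('I_r * P)%type.

Definition letter (j : 'I_l) : 'I_r * bool := tnth (in_tuple w) j.
Definition gen j := (letter j).1.
Definition sgn j := (letter j).2.
Definition lo (j : 'I_l) : P := widen_ord (leqnSn l) j.
Definition hi (j : 'I_l) : P := lift ord0 j.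
(** The edge of step [j] is oriented like its generator, hence against the
    path when the letter is an inverse. *)
Definition src j := if sgn j then hi j else lo j.
Definition tgt j := if sgn j then lo j else hi j.

(** Partitions are represented by the map sending a position to the least
    element of its class.  Besides making the representation unique, this
    makes a vertex the time of its first visit, which later gives a spanning
    tree for free. *)
Definition canon (T : eqType) (f : P -> T) : {ffun P -> P} :=
  [ffun p => [arg min_(q < p | f q == f p) (q : nat)]].

Lemma canonK (T : eqType) (f : P -> T) p : f (canon f p) = f p.
Proof. by rewrite ffunE; case: arg_minnP => // q /eqP. Qed.

Lemma canon_min (T : eqType) (f : P -> T) p q : f q = f p -> (canon f p <= q)%N.
Proof. by move=> fq; rewrite ffunE; case: arg_minnP => // q' _; apply; apply/eqP. Qed.

Lemma canon_eq (T : eqType) (f : P -> T) p q : (canon f p == canon f q) = (f p == f q).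
Proof.
apply/eqP/eqP => [e|e]; first by rewrite -(canonK f p) e canonK.
by apply/val_inj/eqP; rewrite eqn_leq !canon_min //= canonK.
Qed.

Lemma canon_ext (T T' : eqType) (f : P -> T) (f' : P -> T') :
  (forall p q, (f p == f q) = (f' p == f' q)) -> canon f = canon f'.
Proof.
move=> ff'; apply/ffunP=> p; rewrite /canon !ffunE.
case: arg_minnP => // q /eqP fq qm; case: arg_minnP => // q' /eqP fq' q'm.
apply/val_inj/eqP; rewrite eqn_leq qm ?q'm //; first by rewrite -ff' fq.
by rewrite ff' fq'.
Qed.

Lemma canon_canon (T : eqType) (f : P -> T) : canon (canon f) = canon f.
Proof. by apply: canon_ext => p q; rewrite canon_eq. Qed.

Implicit Types (g d h : {ffun P -> P}).

Lemma canon_idem g p : canon g = g -> g (g p) = g p.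
Proof. by move=> gc; rewrite -{2}gc canonK. Qed.

Lemma canon_le g p : canon g = g -> (g p <= p)%N.
Proof. by move=> gc; rewrite -{1}gc canon_min. Qed.

Definition refines d g := [forall p, forall q, (d p == d q) ==> (g p == g q)].

Lemma refinesP d g : reflect (forall p q, d p = d q -> g p = g q) (refines d g).
Proof.
apply: (iffP forallP) => [H p q e|H p].
  by have /forallP/(_ q) := H p; rewrite e eqxx => /eqP.
by apply/forallP=> q; apply/implyP=> /eqP/H->.
Qed.

Lemma refines_refl d : refines d d. Proof. exact/refinesP. Qed.

Lemma refines_trans d g h : refines d g -> refines g h -> refines d h.
Proof. by move=> /refinesP dg /refinesP gh; apply/refinesP=> p q /dg/gh. Qed.

Lemma refines_anti d g : canon d = d -> canon g = g ->
  refines d g -> refines g d -> d = g.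
Proof.
move=> <- <- /refinesP dg /refinesP gd; apply: canon_ext => p q.
apply/eqP/eqP => e; last first.
  by apply/eqP; rewrite -(canon_eq d); apply/eqP/gd/eqP; rewrite canon_eq; apply/eqP.
by apply/eqP; rewrite -(canon_eq g); apply/eqP/dg/eqP; rewrite canon_eq; apply/eqP.
Qed.

Lemma refines_absorb d g p : canon d = d -> refines d g -> g (d p) = g p.
Proof. by move=> dc /refinesP; apply; apply: canon_idem. Qed.

(** Equivalences are used in both directions: an edge is determined by its
    generator and its source, and also by its generator and its target. *)
Definition folded g := [forall j, forall k, (gen j == gen k) ==>
  ((g (src j) == g (src k)) == (g (tgt j) == g (tgt k)))].

Lemma foldedP g : reflect (forall j k, gen j = gen k ->
  (g (src j) == g (src k)) = (g (tgt j) == g (tgt k))) (folded g).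
Proof.
apply: (iffP forallP) => [H j k e|H j].
  by have /forallP/(_ k) := H j; rewrite e eqxx => /eqP.
by apply/forallP=> k; apply/implyP=> /eqP/H->.
Qed.

Definition closed g := g ord0 == g ord_max.

Definition core_graph g := [&& canon g == g, folded g & closed g].

Definition edge g j : U := (gen j, g (src j)).
Definition verts g := [set g p | p : P].
Definition edges g := [set edge g j | j : 'I_l].

Lemma folded_tgt g j k : folded g -> edge g j = edge g k -> g (tgt j) = g (tgt k).
Proof. by move/foldedP=> gf [e1 e2]; apply/eqP; rewrite -gf // e2. Qed.

Lemma refines_edge d g j k : refines d g -> edge d j = edge d k -> edge g j = edge g k.
Proof. by move/refinesP=> dg [e1 /dg e2]; rewrite /edge e1 e2. Qed.

Lemma vertsP g v : canon g = g -> (v \in verts g) = (g v == v).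
Proof.
move=> gc; apply/imsetP/eqP => [[p _ ->]|e]; first exact: canon_idem.
by exists v.
Qed.

Section Closure.
Variables (d : {ffun P -> P}) (t : {set P * P}).

Definition compat g := [&& folded g, refines d g & [forall u in t, g u.1 == g u.2]].

(** The intersection of all the folded partitions that are coarser than [d]
    and merge the pairs in [t], as the kernel of the map sending a position to
    the family of its classes. *)
Definition fold_closure : {ffun P -> P} :=
  canon (fun p => [ffun g : {ffun P -> P} => if compat g then g p else ord0]).

Lemma fold_closureP p q : (forall g, compat g -> g p = g q) <-> fold_closure p = fold_closure q.
Proof.
split=> [H|/eqP]; last first.
  rewrite canon_eq => /eqP/ffunP H g gc; have := H g.
  by rewrite !ffunE gc.
apply/eqP; rewrite canon_eq; apply/eqP/ffunP=> g; rewrite !ffunE.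
by case: ifP => // /H.
Qed.

Lemma fold_closure_canon : canon fold_closure = fold_closure. Proof. exact: canon_canon. Qed.

Lemma fold_closure_min g : compat g -> refines fold_closure g.
Proof. by move=> gc; apply/refinesP=> p q /fold_closureP; apply. Qed.

Lemma fold_closure_compat : compat fold_closure.
Proof.
apply/and3P; split.
- apply/foldedP => j k e; apply/eqP/eqP => /fold_closureP H; apply/fold_closureP => g gc.
    have /and3P[/foldedP gf _ _] := gc; apply/eqP; rewrite -gf //; apply/eqP/H/gc.
  have /and3P[/foldedP gf _ _] := gc; apply/eqP; rewrite gf //; apply/eqP/H/gc.
- apply/refinesP=> p q e; apply/fold_closureP => g /and3P[_ /refinesP dg _]; exact: dg.
- apply/forall_inP=> u ut; apply/eqP/fold_closureP => g /and3P[_ _ /forall_inP gt].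
  by apply/eqP/gt.
Qed.

Lemma compat_fold_closure g : folded g -> compat g = refines fold_closure g.
Proof.
move=> gf; apply/idP/idP => [|clg]; first exact: fold_closure_min.
have /and3P[_ dcl /forall_inP tcl] := fold_closure_compat.
apply/and3P; split=> //; first exact: refines_trans clg.
by apply/forall_inP=> u /tcl/eqP; move/refinesP: clg => /[apply]->.
Qed.

Lemma fold_closure_core : closed d -> core_graph fold_closure.
Proof.
move=> dc; have /and3P[clf /refinesP dcl _] := fold_closure_compat.
rewrite /core_graph fold_closure_canon eqxx clf /=; apply/eqP/dcl/eqP/dc.
Qed.

Lemma card_pffun_bool (A : finType) (S : {set A}) :
  #|[set f : {ffun A -> bool} in pffun_on false (mem S) predT]| = (2 ^ #|S|)%N.
Proof. by rewrite cardsE card_pffun_on card_bool. Qed.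

(** Performing the merges [t] and folding raises the rank E - V + 1 by at most
    the number of merges.  Counted with cohomology over the field with two
    elements: send a cochain z on the edges of the closure and a function h on
    the vertices of [d] to the cochain z + dh of [d], together with the
    differences of h over the pairs in [t] and the restriction of h to the
    vertices of the closure.  If these data vanish, h is constant along [t]
    and dh comes from the closure, so that the partition by the values of h
    inside the closure is again folded and merges [t]; by minimality h is
    constant on the classes of the closure, hence zero, and then z = 0. *)
Lemma rank_fold_closure : canon d = d -> folded d ->
  (#|edges fold_closure| + #|verts d| <= #|edges d| + #|verts fold_closure| + #|t|)%N.
Proof.
move=> dcan dfold.
have /and3P[clf dcl tcl] := fold_closure_compat.
pose FS (A : finType) (S : {set A}) :=
  [set f : {ffun A -> bool} in pffun_on false (mem S) predT].
have FSP (A : finType) (S : {set A}) (f : {ffun A -> bool}) :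
    reflect (forall a, a \notin S -> f a = false) (f \in FS A S).
  rewrite inE; apply: (iffP (@pffun_onP _ _ _ _ _ _)) => [[fS _] a aS|fS].
    by apply: contraNF aS => fa; apply: (subsetP fS); rewrite inE fa.
  by split=> //; apply/subsetP=> a; rewrite inE; apply: contraR => /fS->.
pose dh (h : {ffun P -> bool}) j := h (d (tgt j)) (+) h (d (src j)).
pose M (zh : {ffun U -> bool} * {ffun P -> bool}) :=
  ([ffun e => if [pick j | edge d j == e] is Some j
              then zh.1 (edge fold_closure j) (+) dh zh.2 j else false] : {ffun U -> bool},
   [ffun u : P * P => (u \in t) && (zh.2 (d u.1) (+) zh.2 (d u.2))] : {ffun P * P -> bool},
   [ffun v => (v \in verts fold_closure) && zh.2 (d v)] : {ffun P -> bool}).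
pose X := setX (FS _ (edges fold_closure)) (FS _ (verts d)).
pose Y := setX (setX (FS _ (edges d)) (FS _ t)) (FS _ (verts fold_closure)).
have MXY : M @: X \subset Y.
  apply/subsetP=> _ /imsetP[[z h] _ ->]; rewrite /Y !in_setX /= -!andbA.
  apply/and3P; split; apply/FSP=> a; rewrite ffunE; try by move/negPf->.
  move=> aE; case: pickP => // j /eqP ej; case/negP: aE; rewrite -ej.
  exact: imset_f.
have Minj : {in X &, injective M}.
  move=> [z h] [z' h']; rewrite /X !in_setX /=.
  move=> /andP[zX hX] /andP[z'X h'X] [e1 e2 e3].
  have zF : forall a, a \notin edges fold_closure -> z a = false by apply/FSP.
  have z'F : forall a, a \notin edges fold_closure -> z' a = false by apply/FSP.
  have hF : forall a, a \notin verts d -> h a = false by apply/FSP.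
  have h'F : forall a, a \notin verts d -> h' a = false by apply/FSP.
  pose k p := h (d p) (+) h' (d p).
  have ze j : z (edge fold_closure j) (+) z' (edge fold_closure j) = k (tgt j) (+) k (src j).
    have /ffunP/(_ (edge d j)) := e1; rewrite !ffunE.
    case: pickP => [j' /eqP ej|/(_ j)]; last by rewrite eqxx.
    rewrite /dh (refines_edge dcl ej) (folded_tgt dfold ej).
    have -> : d (src j') = d (src j) := congr1 snd ej.
    rewrite /k; case: (z _); case: (z' _); case: (h (d (tgt j))); case: (h' (d (tgt j)));
    by case: (h (d (src j))); case: (h' (d (src j))).
  have kt u : u \in t -> k u.1 = k u.2.
    move=> ut; have /ffunP/(_ u) := e2; rewrite !ffunE ut /= /k.
    by case: (h (d u.1)); case: (h' (d u.1)); case: (h (d u.2)); case: (h' (d u.2)).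
  have kv v : v \in verts fold_closure -> k v = false.
    move=> vV; have /ffunP/(_ v) := e3; rewrite !ffunE vV /= /k => ->.
    by rewrite addbb.
  pose g := canon (fun p => (fold_closure p, k p)).
  have gE p q : (g p == g q) = (fold_closure p == fold_closure q) && (k p == k q).
    by rewrite canon_eq.
  have gc : compat g.
    apply/and3P; split.
    - apply/foldedP=> i j eij; rewrite !gE.
      have -> : (fold_closure (tgt i) == fold_closure (tgt j)) =
                (fold_closure (src i) == fold_closure (src j)).
        by have /foldedP-> := clf.
      case: (boolP (fold_closure (src i) == fold_closure (src j))) => //= /eqP es.
      have := ze i; have -> : edge fold_closure i = edge fold_closure j by rewrite /edge eij es.
      rewrite ze; case: (k (tgt i)); case: (k (tgt j));
      by case: (k (src i)); case: (k (src j)).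
    - apply/refinesP=> p q e; apply/eqP; rewrite gE /k e eqxx andbT.
      by apply/eqP; move: e; apply/refinesP.
    - apply/forall_inP=> u ut; rewrite gE kt // eqxx andbT.
      by have /forall_inP := tcl; apply.
  have k0 p : k p = false.
    rewrite -(kv (fold_closure p)); last exact: imset_f.
    have /refinesP clg := fold_closure_min gc.
    have /eqP := clg p (fold_closure p) (esym (canon_idem p fold_closure_canon)).
    by rewrite gE => /andP[_ /eqP].
  have hh' : h = h'.
    apply/ffunP=> v; case: (boolP (v \in verts d)) => [|vV]; last by rewrite hF ?h'F.
    rewrite vertsP // => /eqP dv; have := k0 v; rewrite /k dv.
    by case: (h v); case: (h' v).
  congr pair => //; apply/ffunP=> e.
  case: (boolP (e \in edges fold_closure)) => [/imsetP[j _ ->]|eE]; last by rewrite zF ?z'F.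
  by have := ze j; rewrite !k0; case: (z _); case: (z' _).
have := subset_leq_card MXY; rewrite card_in_imset // !cardsX /FS !card_pffun_bool.
rewrite -!expnD leq_exp2l // => h; rewrite addnAC; apply: leq_trans h _.
by rewrite leq_eqVlt addnAC eqxx.
Qed.

End Closure.
End Partitions.

(** * Permutational wreath products *)

Section PermWreath.
Variables (K : groupType) (T : finType).

(** Pairs of a permutation and a label for each point.  The label at [p] is
    the one met when leaving [p], so that the labels of a product multiply
    along the trajectory. *)
Definition perm_wreath := ({perm T} * {ffun T -> K})%type.
HB.instance Definition _ := Choice.on perm_wreath.

Definition perm_wreath_one : perm_wreath := (1%g, [ffun=> 1%g]).
Definition perm_wreath_mul (a b : perm_wreath) : perm_wreath :=
  ((a.1 * b.1)%g, [ffun p => (a.2 p * b.2 (a.1 p))%g]).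
Definition perm_wreath_inv (a : perm_wreath) : perm_wreath :=
  ((a.1^-1)%g, [ffun p => ((a.2 ((a.1^-1)%g p))^-1)%g]).

Lemma perm_wreath_mulA : associative perm_wreath_mul.
Proof.
move=> a b c; congr pair; first exact: mulgA.
by apply/ffunP=> p; rewrite !ffunE /= mulgA permM.
Qed.
Lemma perm_wreath_mul1 : left_id perm_wreath_one perm_wreath_mul.
Proof.
case=> s y; congr pair; first exact: mul1g.
by apply/ffunP=> p; rewrite !ffunE /= mul1g perm1.
Qed.
Lemma perm_wreath_mulr1 : right_id perm_wreath_one perm_wreath_mul.
Proof.
case=> s y; congr pair; first exact: mulg1.
by apply/ffunP=> p; rewrite !ffunE /= mulg1.
Qed.
Lemma perm_wreath_mulV : left_inverse perm_wreath_one perm_wreath_inv perm_wreath_mul.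
Proof.
case=> s y; congr pair; first exact: mulVg.
by apply/ffunP=> p; rewrite !ffunE /= mulVg.
Qed.
Lemma perm_wreath_mulrV : right_inverse perm_wreath_one perm_wreath_inv perm_wreath_mul.
Proof.
case=> s y; congr pair; first exact: mulgV.
by apply/ffunP=> p; rewrite !ffunE /= permK mulgV.
Qed.
HB.instance Definition _ := isGroup.Build perm_wreath perm_wreath_mulA
  perm_wreath_mul1 perm_wreath_mulr1 perm_wreath_mulV perm_wreath_mulrV.

Lemma perm_wreathM_perm (a b : perm_wreath) p : (a * b)%g.1 p = b.1 (a.1 p).
Proof. by rewrite /= permM. Qed.

Lemma perm_wreathM_label (a b : perm_wreath) p : (a * b)%g.2 p = (a.2 p * b.2 (a.1 p))%g.
Proof. by rewrite /= ffunE. Qed.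

Lemma perm_wreath_prod m (q : 'I_m -> perm_wreath) (it : 'I_m.+1 -> T) :
  (forall j, it (lift ord0 j) = (q j).1 (it (widen_ord (leqnSn m) j))) ->
  (\prod_j q j)%g.1 (it ord0) = it ord_max /\
  (\prod_j q j)%g.2 (it ord0) = (\prod_j (q j).2 (it (widen_ord (leqnSn m) j)))%g.
Proof.
elim: m q it => [|m IHm] q it H.
  rewrite !big_ord0 /= ffunE perm1; split=> //; congr it; exact: val_inj.
have w0 : widen_ord (leqnSn m.+1) ord0 = ord0 by apply: val_inj.
have wl j : widen_ord (leqnSn m.+1) (lift ord0 j) = lift ord0 (widen_ord (leqnSn m) j).
  exact: val_inj.
have [|e1 e2] := IHm (fun j => q (lift ord0 j)) (fun p => it (lift ord0 p)).
  by move=> j; rewrite H wl.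
have H0 : (q ord0).1 (it ord0) = it (lift ord0 ord0) by rewrite H w0.
rewrite !big_ord_recl /= !ffunE permM w0 H0 e1 e2; split.
  by congr it; apply: val_inj.
by congr (_ * _)%g; apply: eq_bigr => j _; rewrite wl.
Qed.

Lemma trajectory_exists m (q : 'I_m -> {perm T}) i :
  exists it : {ffun 'I_m.+1 -> T}, it ord0 = i /\
    forall j, it (lift ord0 j) = q j (it (widen_ord (leqnSn m) j)).
Proof.
elim: m q i => [|m IHm] q i; first by exists [ffun=> i]; rewrite ffunE; split=> // -[].
have [it [it0 itS]] := IHm (fun j => q (lift ord0 j)) (q ord0 i).
exists [ffun p => if unlift ord0 p is Some p' then it p' else i].
rewrite ffunE unlift_none; split=> // j; rewrite !ffunE liftK.
case: (unliftP ord0 j) => [k|] ->.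
  have -> : widen_ord (leqnSn m.+1) (lift ord0 k) = lift ord0 (widen_ord (leqnSn m) k).
    exact: val_inj.
  by rewrite liftK itS.
have -> : widen_ord (leqnSn m.+1) ord0 = ord0 :> 'I_m.+2 by apply: val_inj.
by rewrite unlift_none it0.
Qed.

End PermWreath.

(** * Lifts of core graphs and the wreath product formula *)

Section WordValue.
Variables (r : nat) (w : seq ('I_r * bool)).
Notation l := (size w).
Notation P := 'I_l.+1.
Notation U := ('I_r * P)%type.


(** The value of w when the step [j] is read from the element attached to
    [u j]. *)
Definition word_value (G : groupType) (V : Type) (x : V -> G) (u : 'I_l -> V) : G :=
  (\prod_(j < l) (if sgn j then (x (u j))^-1 else x (u j)))%g.

Lemma eq_word_value (G : groupType) (V V' : Type)
    (x : V -> G) (u : 'I_l -> V) (x' : V' -> G) u' :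
  (forall j, x (u j) = x' (u' j)) -> word_value x u = word_value x' u'.
Proof. by move=> e; apply: eq_bigr => j _; rewrite e. Qed.

(** An element is attached to every pair (generator, position), so that the
    sample space is the same for all core graphs. *)
Definition core_mean (G : finGroupType) (chi : G -> algC) (g : {ffun P -> P}) : algC :=
  mean (fun x : {ffun U -> G} => chi (word_value x (edge g))).

(** Only the pattern of coincidences between the steps matters. *)
Lemma mean_word_value (G : finGroupType) (V V' : finType) (u : 'I_l -> V) (u' : 'I_l -> V')
    (chi : G -> algC) :
  (forall j k, (u j == u k) = (u' j == u' k)) ->
  mean (fun x : {ffun V -> G} => chi (word_value x u)) =
  mean (fun x : {ffun V' -> G} => chi (word_value x u')).
Proof.
move=> uu'; pose F (f : {ffun 'I_l -> G}) := chi (word_value f id).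
have := mean_kernel F uu'; rewrite /F => e.
transitivity (mean (fun x : {ffun V -> G} => chi (word_value [ffun j => x (u j)] id))).
  by apply: eq_mean => x; congr chi; apply: eq_word_value => j; rewrite ffunE.
by rewrite e; apply: eq_mean => x; congr chi; apply: eq_word_value => j; rewrite ffunE.
Qed.

Definition trajectory (T : finType) (V : Type) (s : V -> {perm T}) (u : 'I_l -> V)
    (it : {ffun P -> T}) :=
  [forall j, s (u j) (it (src j)) == it (tgt j)].

Section Fixed.
Variables (K : groupType) (T : finType) (V : Type) (x : V -> perm_wreath K T) (u : 'I_l -> V).
Let s v := (x v).1.

Let q (j : 'I_l) := if sgn j then (x (u j))^-1%g else x (u j).

Lemma trajectoryP (it : {ffun P -> T}) :
  reflect (forall j, it (lift ord0 j) = (q j).1 (it (widen_ord (leqnSn l) j)))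
          (trajectory s u it).
Proof.
apply: (iffP forallP) => H j; have := H j; rewrite /q /s /src /tgt /hi /lo.
  by case: (sgn j) => /eqP // <- /=; rewrite permK.
by case: (sgn j) => /= ->; rewrite ?permKV.
Qed.

(** In a wreath product the value of w at a point is the product of the labels
    along its trajectory, that is, the value of w in the lifted graph. *)
Lemma trajectory_value (it : {ffun P -> T}) : trajectory s u it ->
  (word_value x u).1 (it ord0) = it ord_max /\
  (word_value x u).2 (it ord0) =
    word_value (fun v : V * T => (x v.1).2 v.2) (fun j => (u j, it (src j))).
Proof.
move=> tr; have /trajectoryP := tr => /perm_wreath_prod[e1 e2]; split; first exact: e1.
rewrite [LHS]e2; apply: eq_bigr => j _; rewrite /q /src /hi /lo.
have /forallP/(_ j)/eqP := tr; rewrite /s /src /tgt /hi /lo.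
by case: (sgn j) => //= <-; rewrite ffunE permK.
Qed.

(** A trajectory is determined by its starting point. *)
Lemma sum_fixed_trajectory (F : K -> algC) :
  \sum_(i | (word_value x u).1 i == i) F ((word_value x u).2 i) =
  \sum_(it : {ffun P -> T} | trajectory s u it && (it ord0 == it ord_max))
     F (word_value (fun v : V * T => (x v.1).2 v.2) (fun j => (u j, it (src j)))).
Proof.
symmetry; rewrite (partition_big (fun it : {ffun P -> T} => it ord0)
  (fun i => (word_value x u).1 i == i)) /=; last first.
  by move=> it /andP[/trajectory_value[-> _]]; rewrite eq_sym.
apply: eq_bigr => i fi.
have [it [it0 itS]] := trajectory_exists (fun j => (q j).1) i.
have tr : trajectory s u it by apply/trajectoryP.
have [e1 e2] := trajectory_value tr; rewrite it0 in e1 e2.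
rewrite (big_pred1 it) -?e2 // => it'.
apply/andP/eqP => [[/andP[tr' _] /eqP it'0]|->]; last first.
  by rewrite tr -e1 (eqP fi) it0 eqxx.
have tr2 := elimT (trajectoryP _) tr'; apply/ffunP=> p.
elim: {p}(nat_of_ord p) {-2}p (erefl (p : nat)) => [|k IHk] p pk.
  by rewrite (_ : p = ord0) ?it0 ?it'0 //; apply: val_inj.
have kl : (k < l)%N by rewrite -ltnS -pk ltn_ord.
have -> : p = lift ord0 (Ordinal kl) by apply: val_inj.
by rewrite tr2 itS IHk.
Qed.

End Fixed.

Definition coarsen (g : {ffun P -> P}) (e : U) : U := (e.1, g e.2).

(** The expected number of lifts of [d] to a random [n]-sheeted cover of [g]:
    injective placements of the vertices of [d] in the fibres over [g],
    times the probability that the random permutations on the edges of [g]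
    contain the edges of [d]. *)
Definition lift_weight (n : nat) (d g : {ffun P -> P}) : algC :=
  \prod_(v in verts d) (n - #|prec (verts d) g v|)%:R /
  \prod_(e in edges d) (n - #|prec (edges d) (coarsen g) e|)%:R.

Lemma coarsen_edge (d g : {ffun P -> P}) j :
  canon d = d -> refines d g -> coarsen g (edge d j) = edge g j.
Proof. by move=> dc dg; rewrite /coarsen /edge /= refines_absorb. Qed.

Section Wreath.
Variables (T : finType) (g : {ffun P -> P}).
Hypotheses (gcore : core_graph g) (lT : (l <= #|T|)%N) (T0 : (0 < #|T|)%N).

Let gcan : canon g = g. Proof. by have /and3P[/eqP] := gcore. Qed.
Let gfold : folded g. Proof. by have /and3P[] := gcore. Qed.
Let gclosed : closed g. Proof. by have /and3P[] := gcore. Qed.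

(** The core graph of the lifted path: two positions agree when they lie over
    the same vertex of [g] and on the same sheet. *)
Definition trajectory_kernel (it : {ffun P -> T}) : {ffun P -> P} :=
  canon (fun p => (g p, it p)).

Lemma trajectory_kernelE (it : {ffun P -> T}) p q :
  (trajectory_kernel it p == trajectory_kernel it q) = (g p == g q) && (it p == it q).
Proof. by rewrite canon_eq. Qed.

Lemma trajectory_kernel_refines (it : {ffun P -> T}) : refines (trajectory_kernel it) g.
Proof. by apply/refinesP=> p q /eqP; rewrite trajectory_kernelE => /andP[/eqP]. Qed.

Lemma trajectory_kernel_closed (it : {ffun P -> T}) :
  it ord0 == it ord_max -> closed (trajectory_kernel it).
Proof. by rewrite /closed trajectory_kernelE => ->; rewrite andbT; exact: gclosed. Qed.

(** The permutation on an edge of [g] is prescribed at the sources of the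
    edges of the lifted graph above it.  Since [g] is folded, the prescription
    is consistent and injective exactly when the lifted graph is folded. *)
Lemma card_trajectory (it : {ffun P -> T}) :
  (#|[set s : {ffun U -> {perm T}} | trajectory s (edge g) it]|%:R : algC) =
  if folded (trajectory_kernel it) then
    (#|{ffun U -> {perm T}}|)%:R /
    \prod_(e in edges (trajectory_kernel it))
      (#|T| - #|prec (edges (trajectory_kernel it)) (coarsen g) e|)%:R
  else 0.
Proof.
set d := trajectory_kernel it.
have dcan : canon d = d := canon_canon _.
have dg : refines d g := trajectory_kernel_refines it.
have edge_ker j k :
    (edge d j == edge d k) = (edge g j == edge g k) && (it (src j) == it (src k)).
  by rewrite -!pair_eqE /= /pair_eq /= trajectory_kernelE andbA.
case: ifPn => [dfold|dN]; last first.
  rewrite (_ : [set _ | _] = set0) ?cards0 //; apply/setP=> s; rewrite !inE.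
  apply: contraNF dN => /forallP tr; apply/foldedP=> j k ejk; rewrite !trajectory_kernelE.
  have /foldedP/(_ j k ejk) <- := gfold.
  case: (boolP (g (src j) == g (src k))) => //= /eqP egs.
  have eu : edge g j = edge g k by rewrite /edge ejk egs.
  by rewrite -(eqP (tr j)) -(eqP (tr k)) eu (inj_eq perm_inj).
pose D u := [set it (src j) | j : 'I_l & edge g j == u].
pose f u (x : T) :=
  if [pick j | (edge g j == u) && (it (src j) == x)] is Some j then it (tgt j) else x.
have tgtE j k : edge g j = edge g k -> (it (src j) == it (src k)) = (it (tgt j) == it (tgt k)).
  move=> eu; have e1 : gen j = gen k := congr1 fst eu.
  have /foldedP/(_ j k e1) := dfold; rewrite !trajectory_kernelE.
  have e2 : g (src j) = g (src k) := congr1 snd eu.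
  have e3 : g (tgt j) = g (tgt k) by apply: folded_tgt.
  by rewrite e2 e3 !eqxx.
have fE j : f (edge g j) (it (src j)) = it (tgt j).
  rewrite /f; case: pickP => [k /andP[/eqP ek es]|/(_ j)]; last by rewrite !eqxx.
  by apply/eqP; rewrite -tgtE.
have DP u x : reflect (exists2 j, edge g j = u & x = it (src j)) (x \in D u).
  apply: (iffP imsetP) => -[j]; first by rewrite inE => /eqP ju ->; exists j.
  by move=> ju ->; exists j; rewrite // inE ju.
have f_inj u : {in D u &, injective (f u)}.
  move=> _ _ /DP[j ju ->] /DP[k ku ->].
  rewrite -{1}ju -{1}ku !fE => /eqP; rewrite -tgtE ?ju ?ku //; exact/eqP.
have cardD u : #|D u| = #|[set e in edges d | coarsen g e == u]|.
  have -> : D u = (fun e : U => it e.2) @: [set e in edges d | coarsen g e == u].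
    have itd p : it (d p) = it p.
      by have /eqP := canonK (fun p => (g p, it p)) p; rewrite -pair_eqE => /andP[_ /eqP].
    apply/setP=> x; apply/DP/imsetP => [[j ju ->]|[e]].
      exists (edge d j); last by rewrite itd.
      by rewrite inE coarsen_edge // imset_f //= ju.
    rewrite inE => /andP[/imsetP[j _ ->]]; rewrite coarsen_edge // => /eqP ju ->.
    by exists j; rewrite ?itd.
  apply: card_in_imset => e e'; rewrite !inE => /andP[/imsetP[j _ ->]].
  rewrite coarsen_edge // => ju /andP[/imsetP[k _ ->]]; rewrite coarsen_edge // => ku.
  have itd p : it (d p) = it p.
    by have /eqP := canonK (fun p => (g p, it p)) p; rewrite -pair_eqE => /andP[_ /eqP].
  by rewrite /= !itd => es; apply/eqP; rewrite edge_ker (eqP ju) (eqP ku) es !eqxx.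
have Dle u : (#|D u| <= #|T|)%N.
  apply: leq_trans lT; apply: leq_trans (leq_imset_card _ _) _.
  by apply: leq_trans (max_card _) _; rewrite card_ord.
have cardS : #|[set s : {ffun U -> {perm T}} | trajectory s (edge g) it]| =
    (\prod_u (#|T| - #|D u|)`!)%N.
  have -> : (\prod_u (#|T| - #|D u|)`! =
      \prod_u #|[set s : {perm T} | [forall x in D u, s x == f u x]]|)%N.
    by apply: eq_bigr => u _; rewrite card_perm_extend.
  transitivity #|family (fun u =>
      mem [set s : {perm T} | [forall x in D u, s x == f u x]])|.
    apply: eq_card => s; rewrite inE; apply/forallP/familyP => [H u|H j].
      rewrite inE; apply/forall_inP=> _ /DP[j ju ->].
      by rewrite -ju fE.
    have := H (edge g j); rewrite inE => /forall_inP/(_ (it (src j))).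
    by rewrite fE; apply; apply/DP; exists j.
  by rewrite card_family foldrE big_map big_enum.
rewrite cardS card_ffun.
have h1 : (#|{perm T}| = #|T|`!)%N.
  rewrite -[in RHS]cardsT -card_perm; apply: eq_card => s.
  by rewrite [RHS]unfold_in; apply/esym/subsetP=> x; rewrite inE.
rewrite -natr_prod -prod_ffact.
have h2 : ((\prod_u (#|T| - #|D u|)`!) *
    (\prod_u #|T| ^_ #|[set e in edges d | coarsen g e == u]|) =
    #|{perm T}| ^ #|{: U}|)%N.
  rewrite -big_split /= (eq_bigr (fun=> #|T|`!)) => [|u _].
    by rewrite prod_nat_const h1.
  by rewrite -cardD mulnC ffact_fact.
rewrite -h2 natrM mulfK // pnatr_eq0 -lt0n prodn_gt0 // => u.
by rewrite ffact_gt0 -cardD.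
Qed.

Lemma card_trajectory_kernel (t0 : T) (d : {ffun P -> P}) : core_graph d -> refines d g ->
  #|[set it : {ffun P -> T} | (it ord0 == it ord_max) && (trajectory_kernel it == d)]| =
  (\prod_(v in verts d) (#|T| - #|prec (verts d) g v|))%N.
Proof.
case/and3P=> /eqP dcan dfold dclosed dg.
rewrite -(card_fiber_inj t0).
(* A placement of the vertices of [d] is the same as a trajectory with kernel [d]. *)
pose up (h : {ffun P -> T}) : {ffun P -> T} := [ffun p => h (d p)].
pose H := [set h : {ffun P -> T} | (h \in pffun_on t0 (mem (verts d)) predT) &&
  [forall a in verts d, forall b in verts d,
     (g a == g b) ==> (h a == h b) ==> (a == b)]].
transitivity #|H|; last by [].
have HP (h : {ffun P -> T}) : h \in H -> (forall v, v \notin verts d -> h v = t0) /\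
   (forall a b, a \in verts d -> b \in verts d -> g a = g b -> h a = h b -> a = b).
  rewrite inE => /andP[/pffun_onP[hs _] /forall_inP hi]; split=> [v vd|a b ad bd e1 e2].
    by apply/eqP; apply: contraNT vd => hv; apply: (subsetP hs); rewrite inE.
  have /forall_inP/(_ b bd) := hi a ad; rewrite e1 e2 !eqxx => /eqP //.
have up_inj : {in H &, injective up}.
  move=> h h' /HP[h0 _] /HP[h'0 _] /ffunP e; apply/ffunP=> v.
  case: (boolP (v \in verts d)) => [|vd]; last by rewrite h0 ?h'0.
  by rewrite vertsP // => /eqP dv; have := e v; rewrite !ffunE dv.
rewrite -(card_in_imset up_inj); apply: eq_card => it; rewrite inE.
have vd p : d p \in verts d by apply: imset_f.
apply/andP/imsetP => [[_ /eqP kd]|[h hH ->]].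
  have itE p q : d p = d q -> it p = it q.
    by move/eqP; rewrite -kd trajectory_kernelE => /andP[_ /eqP].
  exists [ffun v => if v \in verts d then it v else t0]; last first.
    by apply/ffunP=> p; rewrite !ffunE vd; apply: itE; rewrite canon_idem.
  rewrite inE; apply/andP; split.
    apply/pffun_onP; split=> //; apply/subsetP=> v; rewrite inE ffunE.
    by case: ifP => //; rewrite eqxx.
  apply/forall_inP=> a ad; apply/forall_inP=> b bd; rewrite !ffunE ad bd.
  apply/implyP=> ga; apply/implyP=> ia.
  have : d a == d b by rewrite -kd trajectory_kernelE ga ia.
  by rewrite !vertsP // in ad bd *; rewrite (eqP ad) (eqP bd).
have [h0 hi] := HP _ hH; split.
  by rewrite !ffunE (eqP dclosed).
apply/eqP; rewrite -[RHS]dcan; apply: canon_ext => p q.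
rewrite !ffunE -pair_eqE /=; apply/andP/eqP => [[/eqP gp /eqP hp]|e].
  by apply: hi => //; rewrite !refines_absorb.
by rewrite e eqxx; split=> //; apply/eqP; move: e; apply/refinesP.
Qed.

Theorem wreath_formula (G : finGroupType) (chi : G -> algC) :
  mean (fun s : {ffun U -> {perm T}} => mean (fun y : {ffun U * T -> G} =>
    let x u : perm_wreath G T := (s u, [ffun t => y (u, t)]) in
    \sum_(i | (word_value x (edge g)).1 i == i) chi ((word_value x (edge g)).2 i))) =
  \sum_(d | core_graph d && refines d g) lift_weight #|T| d g * core_mean chi d.
Proof.
have [t0 _] : exists t0 : T, true by case/card_gt0P: T0 => t0; exists t0.
pose C (it : {ffun P -> T}) := mean (fun y : {ffun U * T -> G} =>
  chi (word_value y (fun j => (edge g j, it (src j))))).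
have CE it : C it = core_mean chi (trajectory_kernel it).
  apply: mean_word_value => j k.
  rewrite -!pair_eqE /= /pair_eq /= -!pair_eqE /= /pair_eq /= trajectory_kernelE.
  by rewrite andbA.
transitivity (mean (fun s : {ffun U -> {perm T}} =>
    \sum_(it : {ffun P -> T} | trajectory s (edge g) it && (it ord0 == it ord_max)) C it)).
  apply: eq_mean => s.
  transitivity (mean (fun y : {ffun U * T -> G} =>
    \sum_(it : {ffun P -> T} | trajectory s (edge g) it && (it ord0 == it ord_max))
       chi (word_value y (fun j => (edge g j, it (src j)))))).
    apply: eq_mean => y /=; rewrite sum_fixed_trajectory; apply: eq_bigr => it _; congr chi.
    by apply: eq_word_value => j; rewrite /= ffunE.
  by rewrite /mean exchange_big /= mulr_suml.
transitivity (\sum_(it : {ffun P -> T} | it ord0 == it ord_max)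
   (#|[set s : {ffun U -> {perm T}} | trajectory s (edge g) it]|%:R /
    (#|{ffun U -> {perm T}}|)%:R) * C it).
  rewrite /mean.
  under eq_bigr do rewrite big_mkcondl /=.
  rewrite exchange_big mulr_suml; apply: eq_bigr => it _.
  rewrite -big_mkcond sumr_const -[C it *+ _]mulr_natl [RHS]mulrAC; congr (_%:R * _ / _).
  by apply: eq_card => s; rewrite inE.
pose Q (it : {ffun P -> T}) := folded (trajectory_kernel it).
rewrite (bigID Q) /= [X in _ + X]big1 ?addr0 => [|it /andP[_ /negPf nf]]; last first.
  by rewrite card_trajectory -/(Q it) nf !mul0r.
rewrite (partition_big trajectory_kernel (fun d => core_graph d && refines d g)) /=; last first.
  move=> it /andP[ic itf]; rewrite trajectory_kernel_refines andbT /core_graph canon_canon eqxx.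
  by rewrite trajectory_kernel_closed // andbT.
apply: eq_bigr => d /andP[dcore dg]; have /and3P[_ dfold _] := dcore.
rewrite (eq_bigr (fun=>
    (\prod_(e in edges d) (#|T| - #|prec (edges d) (coarsen g) e|)%:R)^-1 *
    core_mean chi d)).
  rewrite (eq_bigl (mem [set it : {ffun P -> T} |
      (it ord0 == it ord_max) && (trajectory_kernel it == d)])).
    by rewrite sumr_const card_trajectory_kernel // -[LHS]mulr_natl natr_prod mulrA.
  move=> it; rewrite !inE -andbA; congr (_ && _).
  by case: (eqVneq (trajectory_kernel it) d) => [kd|]; rewrite ?andbF ?andbT //= /Q kd dfold.

move=> it /andP[/andP[ic itf] /eqP kd].
rewrite card_trajectory -/(Q it) itf CE kd; congr (_ * _).
rewrite mulrAC divff ?mul1r // pnatr_eq0 -lt0n; apply/card_gt0P.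
by exists [ffun=> 1%g].
Qed.

End Wreath.
End WordValue.

(** * Free groups and uniformity of primitive words *)

Section FreeGroupExtra.
Local Open Scope group_scope.
Variable I : choiceType.

Lemma fg_lift1 (G : groupType) (b : I -> G) : fg_lift b 1 = 1.
Proof. exact: gmulf1. Qed.

Lemma fg_liftV (G : groupType) (b : I -> G) u : fg_lift b u^-1 = (fg_lift b u)^-1.
Proof. exact: gmulfV. Qed.

Lemma fg_lift_uniq (G : groupType) (f : freegroup I -> G) (b : I -> G) :
  {morph f : u v / u * v} -> (forall i, f (fg_gen i) = b i) -> f =1 fg_lift b.
Proof.
move=> fM fb.
have f1 : f 1 = 1 by apply: (@mulgI _ (f 1)); rewrite -fM !mulg1.
have mm : monoid.monoid_morphism f by split.
pose F : {multiplicative freegroup I -> G} :=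
  HB.pack f (isUMagmaMorphism.Build _ _ f mm).
move=> u; have := fg_lift_unique F u => /= ->.
by apply: eq_bigr => a _; rewrite /letter_eval /= fb.
Qed.

Lemma fg_lift_id (u : freegroup I) : fg_lift (@fg_gen I) u = u.
Proof. exact/esym/(@fg_lift_uniq _ id). Qed.

Lemma fg_lift_comp (J : choiceType) (G : groupType) (b : I -> freegroup J) (c : J -> G) u :
  fg_lift c (fg_lift b u) = fg_lift (fun i => fg_lift c (b i)) u.
Proof.
apply: (@fg_lift_uniq _ (fun u => fg_lift c (fg_lift b u))) => [x y|i].
  by rewrite !fg_liftM.
by rewrite fg_lift_gen.
Qed.

Lemma eq_fg_lift (G : groupType) (b c : I -> G) : b =1 c -> fg_lift b =1 fg_lift c.
Proof.
by move=> bc u; apply: eq_bigr => a _; rewrite /letter_eval bc.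
Qed.

(** On the stabilizer of [p] the label at [p] is a homomorphism. *)
Lemma fg_lift_stab (K : groupType) (T : finType) (p : T)
    (b : I -> perm_wreath K T) (c : I -> K) :
  (forall i, (b i).1 p = p) -> (forall i, (b i).2 p = c i) ->
  forall u, (fg_lift b u).1 p = p /\ (fg_lift b u).2 p = fg_lift c u.
Proof.
move=> b1 b2 [s rs]; rewrite /fg_lift /= {rs}; elim: s => [|[i e] s [IH1 IH2]].
  by rewrite !big_nil /= ffunE perm1.
have e1 : (letter_eval b (i, e)).1 p = p.
  by rewrite /letter_eval /=; case: e; rewrite //= -{1}[p](b1 i) permK.
rewrite !big_cons /= ffunE permM e1 IH1 IH2; split=> //; congr (_ * _).
rewrite /letter_eval /=; case: e {e1} => //=.
by rewrite ffunE -{1}[p](b1 i) permK b2.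
Qed.

End FreeGroupExtra.

Section PrimitiveUniform.
Variables (J : finType) (W : freegroup J) (I : choiceType) (b : I -> freegroup J) (i0 : I).
Hypotheses (b_bij : bijective (fg_lift b)) (bW : b i0 = W).

(** Multiplying on the right by [a] the image of the basis element [W], and
    keeping the images of the others, permutes the homomorphisms from the free
    group to [G] and translates the value of [W]. *)
Lemma primitive_mean (G : finGroupType) (chi : G -> algC) :
  mean (fun z : {ffun J -> G} => chi (fg_lift z W)) = mean chi.
Proof.
have [inv invK bK] := b_bij.
have invM : {morph inv : u v / (u * v)%g}.
  by move=> u v; apply: (can_inj invK); rewrite fg_liftM !bK.
pose B (z : {ffun J -> G}) (a : G) i :=
  if i == i0 then (fg_lift z (b i) * a)%g else fg_lift z (b i).
pose sh (a : G) (z : {ffun J -> G}) : {ffun J -> G} :=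
  [ffun j => fg_lift (B z a) (inv (fg_gen j))].
have shE a z i : fg_lift (sh a z) (b i) = B z a i.
  rewrite -[RHS]fg_lift_gen -[fg_gen i]invK fg_lift_gen.
  apply/esym/(@fg_lift_uniq _ _ (fun u => fg_lift (B z a) (inv u))) => [u v|j].
    by rewrite invM fg_liftM.
  by rewrite ffunE.
have shK a : cancel (sh a) (sh a^-1%g).
  move=> z; apply/ffunP=> j; rewrite ffunE.
  have e : B (sh a z) a^-1%g =1 (fun i => fg_lift z (b i)).
    by move=> i; rewrite /B shE /B; case: eqP => // _; rewrite mulgK.
  by rewrite (eq_fg_lift e) -fg_lift_comp bK fg_lift_gen.
have sh_bij a : bijective (sh a).
  by exists (sh a^-1%g) => //; rewrite -{2}[a]invgK; apply: shK.
have key a : mean (fun z : {ffun J -> G} => chi (fg_lift z W)) =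
             mean (fun z : {ffun J -> G} => chi (fg_lift z W * a)%g).
  rewrite -(mean_bij (fun z : {ffun J -> G} => chi (fg_lift z W)) (sh_bij a)).
  by apply: eq_mean => z; rewrite -bW shE /B eqxx.
have G0 : (0 < #|G|)%N by apply/card_gt0P; exists 1%g.
transitivity (mean (fun a : G => mean (fun z : {ffun J -> G} => chi (fg_lift z W * a)%g))).
  rewrite -(mean_const (mean (fun z : {ffun J -> G} => chi (fg_lift z W))) G0).
  exact: eq_mean.
rewrite {1}/mean {1}/mean -mulr_suml exchange_big /=.
rewrite (eq_bigr (fun=> \sum_a chi a)) => [|z _].
  rewrite sumr_const -[_ *+ _]mulr_natr mulfK //.
  by rewrite pnatr_eq0 -lt0n; apply/card_gt0P; exists [ffun=> 1%g].
by rewrite [RHS](reindex_inj (mulgI (fg_lift z W))).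
Qed.

End PrimitiveUniform.

(** * Fundamental groups of core graphs *)

Section SpanningTree.
Variables (r : nat) (w : seq ('I_r * bool)).
Notation l := (size w).
Notation P := 'I_l.+1.
Notation U := ('I_r * P)%type.
Variable g : {ffun P -> P}.
Hypothesis gcore : core_graph g.

Let gcan : canon g = g. Proof. by have /and3P[/eqP] := gcore. Qed.
Let gfold : folded g. Proof. by have /and3P[] := gcore. Qed.
Let gclosed : closed g. Proof. by have /and3P[] := gcore. Qed.
Let gg p : g (g p) = g p. Proof. exact: canon_idem. Qed.
Let gle p : (g p <= p)%N. Proof. exact: canon_le. Qed.

Lemma hiE (j : 'I_l) : hi j = j.+1 :> nat. Proof. by rewrite /hi /= /bump. Qed.
Lemma loE (j : 'I_l) : lo j = j :> nat. Proof. by []. Qed.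

(** The steps that discover a new vertex form a spanning tree. *)
Definition tree_step (j : 'I_l) := g (hi j) == hi j.
Definition tree_edges : {set U} := [set edge g j | j : 'I_l & tree_step j].
Definition cotree : {set U} := edges g :\: tree_edges.

Lemma canon_ord0 : g ord0 = ord0.
Proof. by apply/val_inj/eqP; rewrite /= -leqn0 gle. Qed.

(** The later end of a tree edge is the vertex that it discovers. *)
Lemma tree_step_inj j k : tree_step j -> tree_step k -> edge g j = edge g k -> j = k.
Proof.
have mx i : tree_step i -> maxn (g (src i)) (g (tgt i)) = i.+1.
  rewrite /tree_step /src /tgt => /eqP e; have := gle (lo i); rewrite loE => h.
  by case: (sgn i); rewrite e hiE; [apply/maxn_idPl | apply/maxn_idPr]; apply: leqW.
move=> /mx ej /mx ek e; apply/val_inj/succn_inj => /=.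
by rewrite -ej -ek (folded_tgt gfold e) (congr1 snd e : g (src j) = g (src k)).
Qed.

Lemma card_verts : #|verts g| = #|tree_edges|.+1.
Proof.
have -> : #|tree_edges| = #|[set j : 'I_l | tree_step j]|.
  rewrite /tree_edges card_in_imset; last first.
    by move=> j k; rewrite !inE; apply: tree_step_inj.
  by apply: eq_card => j; rewrite !inE.
have -> : verts g = ord0 |: (@hi r w) @: [set j : 'I_l | tree_step j].
  apply/setP=> v; rewrite vertsP // !inE; apply/eqP/orP => [gv|[/eqP->|/imsetP[j]]].
  - case: (unliftP ord0 v) gv => [j|] -> gv; [right|by left].
    by apply/imsetP; exists j; rewrite ?inE /tree_step /hi ?gv.
  - exact: canon_ord0.
  - by rewrite inE => /eqP gj ->.
rewrite cardsU1 card_imset ?add1n; last by move=> j k /lift_inj.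
rewrite (_ : _ \notin _) //; apply/imsetP => -[j _ /(congr1 val)].
by rewrite /= /bump.
Qed.

Lemma card_cotree : (#|cotree| + #|verts g| = #|edges g|.+1)%N.
Proof.
rewrite card_verts addnS; congr _.+1; rewrite addnC -(cardsID tree_edges (edges g)).
congr (_ + _)%N; congr #|pred_of_set _|; apply/esym/setIidPr/subsetP => _ /imsetP[j _ ->].
exact: imset_f.
Qed.

Section Gauge.
Variables (G : groupType) (x : U -> G).
Local Open Scope group_scope.

Definition step j := if sgn j then (x (edge g j))^-1 else x (edge g j).

(** The value of the path to a vertex inside the spanning tree, defined for
    the vertices visited up to time [k]. *)
Fixpoint gauge_upto k (q : P) : G :=
  if k is k'.+1 then
    if g q == k :> nat then
      (if insub k' is Some j then gauge_upto k' (lo j) * step j else 1)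
    else gauge_upto k' q
  else 1.

Definition gauge := gauge_upto l.

Lemma gauge_upto_stable k m q : (g q <= k)%N -> gauge_upto (k + m) q = gauge_upto k q.
Proof.
move=> gk; elim: m => [|m IHm]; first by rewrite addn0.
by rewrite addnS /= ifN // ltn_eqF // ltnS (leq_trans gk) ?leq_addr.
Qed.

Lemma gauge_uptoE k q : (k <= l)%N -> (g q <= k)%N -> gauge_upto k q = gauge q.
Proof. by move=> kl gk; rewrite /gauge -(subnKC kl) gauge_upto_stable. Qed.

Lemma gauge_rep q : gauge (g q) = gauge q.
Proof.
have rep m : gauge_upto m (g q) = gauge_upto m q by elim: m => //= k IHk; rewrite gg IHk.
exact: rep.
Qed.

Lemma gauge0 : gauge ord0 = 1.
Proof. by rewrite -(@gauge_uptoE 0) // canon_ord0. Qed.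

Lemma gauge_tree j : tree_step j -> gauge (hi j) = gauge (lo j) * step j.
Proof.
move=> /eqP gj; rewrite -(@gauge_uptoE j.+1) ?gj ?hiE //=.
rewrite gj hiE eqxx insubT // => jl; rewrite (_ : Sub _ _ = j); last exact: val_inj.
by rewrite gauge_uptoE // ltnW.
Qed.

Definition etgt (e : U) := if [pick j | edge g j == e] is Some j then g (tgt j) else ord0.

Lemma etgtE j : etgt (edge g j) = g (tgt j).
Proof.
rewrite /etgt; case: pickP => [k /eqP|/(_ j)]; last by rewrite eqxx.
exact: folded_tgt.
Qed.

(** Conjugating by the tree paths turns each edge into a loop at the base
    vertex, and makes the tree edges trivial. *)
Definition gauged (e : U) := gauge e.2 * x e * (gauge (etgt e))^-1.

Lemma gauged_edge j : gauged (edge g j) = gauge (src j) * x (edge g j) * (gauge (tgt j))^-1.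
Proof. by rewrite /gauged etgtE /= !gauge_rep. Qed.

Lemma gauged_tree e : e \in tree_edges -> gauged e = 1.
Proof.
case/imsetP=> j; rewrite inE => tj ->; rewrite gauged_edge.
have := gauge_tree tj; rewrite /src /tgt /step.
case: (sgn j) => ->; rewrite ?mulgKV ?mulgV //.
Qed.

Lemma telescope m (a : 'I_m.+1 -> G) (b : 'I_m -> G) :
  \prod_j (a (widen_ord (leqnSn m) j) * b j * (a (lift ord0 j))^-1) =
  a ord0 * (\prod_j b j) * (a ord_max)^-1.
Proof.
elim: m a b => [|m IHm] a b.
  by rewrite !big_ord0 mulg1 (_ : ord_max = ord0) ?mulgV //; apply: val_inj.
rewrite !big_ord_recl.
have := IHm (fun p => a (lift ord0 p)) (fun j => b (lift ord0 j)).
rewrite (_ : widen_ord _ ord0 = ord0); last exact: val_inj.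
rewrite (_ : lift ord0 ord_max = ord_max); last exact: val_inj.
rewrite (eq_bigr (fun j => a (widen_ord (leqnSn m.+1) (lift ord0 j)) * b (lift ord0 j) *
   (a (lift ord0 (lift ord0 j)))^-1)) => [->|j _]; last first.
  by congr (a _ * _ * _); apply: val_inj.
by rewrite -!mulgA mulKg.
Qed.

Lemma word_value_gauged : word_value gauged (edge g) = word_value x (edge g).
Proof.
have e0 : gauge ord_max = 1.
  by rewrite -gauge_rep -(eqP gclosed) gauge_rep gauge0.
have -> : word_value x (edge g) = \prod_j step j by [].
have := telescope gauge step; rewrite gauge0 e0 mul1g invg1 mulg1 => <-.
apply: eq_bigr => j _; rewrite gauged_edge /step /src /tgt /lo /hi.
by case: (sgn j); rewrite // !invMg invgK mulgA.
Qed.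

End Gauge.

Lemma eq_gauge (G : groupType) (x x' : U -> G) :
  {in tree_edges, x =1 x'} -> gauge x =1 gauge x'.
Proof.
move=> xx'; have upto m : gauge_upto x m =1 gauge_upto x' m; last exact: upto.
elim: m => //= k IHk q; rewrite -IHk.
case: eqP => // gq; case: insubP => // j _ jk; rewrite IHk; congr (_ * _)%g.
have tj : tree_step j.
  by rewrite /tree_step (_ : hi j = g q) ?gg //; apply/val_inj; rewrite /= gq -jk.
have ej : edge g j \in tree_edges by apply/imsetP; exists j; rewrite ?inE.
by rewrite /step xx'.
Qed.

Let k := #|cotree|.

Definition coedge (i : 'I_k) : U := enum_val i.

Lemma coedge_in i : coedge i \in cotree. Proof. exact: enum_valP. Qed.

Definition ext (G : groupType) (z : 'I_k -> G) (e : U) : G :=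
  if [pick i | coedge i == e] is Some i then z i else 1%g.

Lemma ext_coedge (G : groupType) (z : 'I_k -> G) i : ext z (coedge i) = z i.
Proof.
rewrite /ext; case: pickP => [i' /eqP/enum_val_inj-> //|/(_ i)].
by rewrite eqxx.
Qed.

Lemma ext_out (G : groupType) (z : 'I_k -> G) e : e \notin cotree -> ext z e = 1%g.
Proof.
by move=> ne; rewrite /ext; case: pickP => // i /eqP ei; rewrite -ei coedge_in in ne.
Qed.

Lemma cotreeP e : e \in cotree -> exists i, e = coedge i.
Proof. by move=> ec; exists (enum_rank_in ec e); rewrite /coedge enum_rankK_in. Qed.

(** The word w in the free fundamental group of [g], whose basis is the set of
    edges outside the tree. *)
Definition loop_word : freegroup 'I_k := word_value (ext (@fg_gen _)) (edge g).

Lemma lift_loop_word (G : groupType) (z : 'I_k -> G) :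
  fg_lift z loop_word = word_value (ext z) (edge g).
Proof.
rewrite /loop_word /word_value gmulf_prod; apply: eq_bigr => j _.
have e : fg_lift z (ext (@fg_gen _) (edge g j)) = ext z (edge g j).
  by rewrite /ext; case: pickP => [i _|_]; rewrite ?fg_lift1 ?fg_lift_gen.
by case: (sgn j); rewrite /= ?fg_liftV; [congr (_^-1)%g|]; exact: e.
Qed.

Lemma word_value_loop (G : groupType) (x : U -> G) :
  word_value x (edge g) = fg_lift (fun i => gauged x (coedge i)) loop_word.
Proof.
rewrite -word_value_gauged lift_loop_word; apply: eq_word_value => j.
case: (boolP (edge g j \in cotree)) => [/cotreeP[i ->]|jN]; first by rewrite ext_coedge.
rewrite ext_out // gauged_tree //; apply: contraNT jN => jN.
by rewrite inE jN imset_f.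
Qed.

(** Replacing the elements on the edges outside the tree by their gauged
    versions is a bijection, as the gauge only depends on the tree edges. *)
Lemma core_mean_loop (G : finGroupType) (chi : G -> algC) :
  core_mean chi g = mean (fun z : {ffun 'I_k -> G} => chi (fg_lift z loop_word)).
Proof.
pose rho (x : {ffun U -> G}) : {ffun U -> G} :=
  [ffun e => if e \in cotree then gauged x e else x e].
have rho_inj : injective rho.
  move=> x x' /ffunP exx'.
  have off e : e \notin cotree -> x e = x' e.
    by move=> ne; have := exx' e; rewrite !ffunE (negPf ne).
  have gxx' : gauge x =1 gauge x'.
    by apply: eq_gauge => e et; apply: off; rewrite inE et.
  apply/ffunP=> e; case: (boolP (e \in cotree)) => [ec|/off//].
  have := exx' e; rewrite !ffunE ec /gauged !gxx'.
  by move/mulIg/mulgI.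
rewrite -(@mean_ffun_inj _ _ _ coedge
  (fun z : {ffun 'I_k -> G} => chi (fg_lift z loop_word))); last exact: enum_val_inj.
rewrite -(mean_bij _ (injF_bij rho_inj)).
apply: eq_mean => x; congr chi; rewrite word_value_loop; apply: eq_fg_lift => i.
by rewrite !ffunE coedge_in.
Qed.

(** The map induced on fundamental groups by the labelling of the edges by
    generators of F_r. *)
Definition loop_embed : freegroup 'I_k -> freegroup 'I_r :=
  fg_lift (fun i => gauged (fun e : U => fg_gen e.1) (coedge i)).

(** Complete the partial injections given by the edges of [g] to permutations
    of the positions, and label the edges outside the tree by the basis of the
    fundamental group.  This defines a homomorphism from F_r to a wreath
    product, and the label at the base vertex is a left inverse. *)
Lemma loop_embed_inj : injective loop_embed.
Proof.
pose x0 (e : U) : freegroup 'I_r := fg_gen e.1.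
pose D c := [set g (src j) | j : 'I_l & gen j == c].
pose f c (p : P) :=
  if [pick j | (gen j == c) && (g (src j) == p)] is Some j then g (tgt j) else p.
have fE j : f (gen j) (g (src j)) = g (tgt j).
  rewrite /f; case: pickP => [i /andP[/eqP ei es]|/(_ j)]; last by rewrite !eqxx.
  by apply/eqP; have /foldedP/(_ _ _ ei) <- := gfold.
(* [folded] makes [f c] injective on the sources of the edges with generator [c]. *)
have sigP c : exists s : {perm P}, [forall p in D c, s p == f c p].
  suff [s sf] : exists s : {perm P}, {in D c, s =1 f c}.
    by exists s; apply/forall_inP => p /sf->.
  apply: perm_extend => _ _ /imsetP[i + ->] /imsetP[j + ->]; rewrite !inE.
  move=> /eqP ei /eqP ej; rewrite -{1}ei -{1}ej !fE => /eqP.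
  by have /foldedP <- := gfold; rewrite ?ei ?ej // => /eqP.
have [sig sigE] : exists sig : 'I_r -> {perm P}, forall j, sig (gen j) (g (src j)) = g (tgt j).
  pose sg c := xchoose (sigP c); exists sg => j; rewrite -fE.
  have /forall_inP/(_ (g (src j))) := xchooseP (sigP (gen j)) => H.
  by apply/eqP/H/imsetP; exists j; rewrite ?inE.
pose y := ext (@fg_gen 'I_k).
pose th c : perm_wreath (freegroup 'I_k) P := (sig c, [ffun p => y (c, p)]).
have thE j : (th (gen j)).1 (g (src j)) = g (tgt j) /\
             (th (gen j)).2 (g (src j)) = y (edge g j).
  by rewrite /= sigE ffunE.
have thVE j : ((th (gen j))^-1%g).1 (g (tgt j)) = g (src j) /\
              ((th (gen j))^-1%g).2 (g (tgt j)) = ((y (edge g j))^-1)%g.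
  have [<- e2] := thE j; rewrite /= ffunE permK; split=> //.
  by rewrite ffunE.
have thx j : fg_lift th (x0 (edge g j)) = th (gen j) by rewrite /x0 fg_lift_gen.
(* Tree paths lead from the base to their end vertex and carry trivial labels. *)
have gaugeE q : (fg_lift th (gauge x0 q)).1 ord0 = g q /\
                (fg_lift th (gauge x0 q)).2 ord0 = 1%g.
  elim: {q}(nat_of_ord (g q)) {-2}q (leqnn (g q)) => [|m IHm] q gq.
    rewrite -gauge_rep (_ : g q = ord0); last by apply/val_inj/eqP; rewrite /= -leqn0.
    by rewrite gauge0 fg_lift1 /= ffunE perm1.
  move: gq; rewrite leq_eqVlt => /orP[/eqP gq|]; last by rewrite ltnS; apply: IHm.
  have ml : (m < l)%N by rewrite -ltnS -gq ltn_ord.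
  pose j := Ordinal ml; have gj : hi j = g q by apply/val_inj; rewrite /= gq.
  have tj : tree_step j by rewrite /tree_step gj gg.
  have [IH1 IH2] := IHm (lo j) (gle (lo j)).
  rewrite -gauge_rep -gj gauge_tree // fg_liftM /= ffunE permM IH1 IH2 mul1g.
  have yj : y (edge g j) = 1%g.
    apply: ext_out; rewrite inE negb_and negbK; apply/orP; left.
    by apply/imsetP; exists j; rewrite ?inE.
  have ghi : hi j = g (hi j) by rewrite gj gg.
  rewrite [X in _ = X /\ _]ghi /step; have [] := thE j; have [] := thVE j; rewrite /src /tgt.
  case: (sgn j) => E1 E2 E3 E4; rewrite ?fg_liftV thx.
    by rewrite E1 E2 yj invg1.
  by rewrite E3 E4 yj.
pose b i := fg_lift th (gauged x0 (coedge i)).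
have [b1 b2] : (forall i, (b i).1 ord0 = ord0) /\ (forall i, (b i).2 ord0 = fg_gen i).
  have bb i : (b i).1 ord0 = ord0 /\ (b i).2 ord0 = fg_gen i.
    have /setDP[/imsetP[j _ ej] _] := coedge_in i.
    have yj : y (edge g j) = fg_gen i by rewrite -ej /y ext_coedge.
    rewrite /b ej gauged_edge !fg_liftM fg_liftV thx.
    have [E1 E2] := gaugeE (src j); have [E3 E4] := thE j.
    have [E5 E6] := gaugeE (tgt j).
    move: (fg_lift th _) (fg_lift th _) E1 E2 E5 E6 => B A A1 A2 B1 B2.
    have B3 : (B^-1)%g.1 (g (tgt j)) = ord0 by rewrite -B1 /= permK.
    have B4 : (B^-1)%g.2 (g (tgt j)) = 1%g by rewrite /= ffunE -B1 permK B2 invg1.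
    by rewrite !(perm_wreathM_perm, perm_wreathM_label) A1 A2 E3 E4 B3 B4 mul1g mulg1.
  by split=> i; have [] := bb i.
have psiK u : (fg_lift th (loop_embed u)).2 ord0 = u.
  rewrite /loop_embed fg_lift_comp; have [_] := fg_lift_stab b1 b2 u.
  by move=> ->; apply: fg_lift_id.
by move=> u v uv; rewrite -(psiK u) uv psiK.
Qed.

End SpanningTree.

Section Dichotomy.
Variables (r : nat) (w : freegroup 'I_r) (g : {ffun 'I_(size w).+1 -> 'I_(size w).+1}).
Hypothesis gcore : core_graph g.

Lemma fg_lift_word_value (G : groupType) (b : 'I_r -> G) :
  fg_lift b w = word_value (fun e => b e.1) (edge g).
Proof. by rewrite /fg_lift big_tnth. Qed.

Lemma loop_embed_word : @loop_embed r w g (loop_word g) = w.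
Proof. by rewrite /loop_embed -word_value_loop // -fg_lift_word_value fg_lift_id. Qed.

(** The subgroup in question is the image of the fundamental group of [g]. *)
Theorem primitive_or_rank :
  nonprimitive_rank w #|cotree g| \/
  forall (G : finGroupType) (chi : G -> algC), core_mean chi g = mean chi.
Proof.
pose H y := exists u, @loop_embed r w g u = y.
have Hw : H w by exists (loop_word g); apply: loop_embed_word.
case: (pselect (primitive_in H w)) => [[I [b [[b_inj bH] [i0 bi0]]]]|np]; last first.
  left; exists H; split=> //.
    split=> [|_ _ [u <-] [v <-]]; first by exists 1%g; rewrite /loop_embed fg_lift1.
    by exists (u * v^-1)%g; rewrite /loop_embed fg_liftM fg_liftV.
  exists (fun i => gauged g (fun e => fg_gen e.1) (coedge i)).
  by split=> //; apply: loop_embed_inj.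
right=> G chi.
have bP i : exists u, @loop_embed r w g u == b i.
  have [_ +] := bH (b i); case=> [|u <-]; last by exists u.
  by exists (fg_gen i); rewrite fg_lift_gen.
pose be i := xchoose (bP i).
have beE i : @loop_embed r w g (be i) = b i by apply/eqP; apply: (xchooseP (bP i)).
have beL u : @loop_embed r w g (fg_lift be u) = fg_lift b u.
  by rewrite /loop_embed fg_lift_comp; apply: eq_fg_lift => i; apply: beE.
have be_surj v : exists u, fg_lift be u == v.
  have [+ _] := bH (@loop_embed r w g v); case=> [|u eu]; first by exists v.
  by exists u; apply/eqP/(@loop_embed_inj _ _ _ gcore); rewrite beL.
(* [be] is the basis [b] pulled back along the embedding. *)
have be_bij : bijective (fg_lift be).
  have invK v : fg_lift be (xchoose (be_surj v)) = v.
    by apply/eqP; apply: (xchooseP (be_surj v)).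
  exists (fun v => xchoose (be_surj v)) => // u.
  by apply: b_inj; rewrite -!beL invK.
have be0 : be i0 = loop_word g.
  by apply: (@loop_embed_inj _ _ _ gcore); rewrite beE bi0 loop_embed_word.
rewrite core_mean_loop //; exact: primitive_mean be_bij be0 _ chi.
Qed.

End Dichotomy.

(** * Regrouping the lift weights by closures of merges *)

Section Expand.
Variables (r : nat) (w : seq ('I_r * bool)).
Notation l := (size w).
Notation P := 'I_l.+1.
Notation U := ('I_r * P)%type.
Notation part := {ffun P -> P}.

(** For each vertex and each edge, the set of earlier ones with which it is
    merged. *)
Definition merging := ({ffun P -> {set P}} * {ffun U -> {set U}})%type.

Definition merged (a : merging) : {set P * P} :=
  [set u | u.2 \in a.1 u.1] :|:
  [set (e.1.2, e.2.2) | e : U * U & e.2 \in a.2 e.1].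

Definition merging_size (a : merging) : nat := \sum_p #|a.1 p| + \sum_e #|a.2 e|.

Lemma card_graph (A : finType) (F : {ffun A -> {set A}}) :
  #|[set u : A * A | u.2 \in F u.1]| = (\sum_p #|F p|)%N.
Proof.
rewrite -sum1dep_card (eq_bigl (fun u : A * A => true && (u.2 \in F u.1))) //.
rewrite -(pair_big_dep xpredT (fun p q => q \in F p) (fun _ _ => 1%N)) /=.
by apply: eq_bigr => p _; rewrite sum1_card.
Qed.

Lemma card_merged a : (#|merged a| <= merging_size a)%N.
Proof.
apply: leq_trans (leq_card_setU _ _) _; rewrite card_graph leq_add2l.
apply: leq_trans (leq_imset_card _ _) _; rewrite -card_graph.
by apply: subset_leq_card; apply/subsetP => e; rewrite !inE.
Qed.

Definition same_gen (a : merging) := [forall e : U, forall e' in a.2 e, e'.1 == e.1].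

Definition valid (d : part) (a : merging) :=
  [&& admissible (verts d) a.1, admissible (edges d) a.2 & same_gen a].

Definition merge_closure (d : part) (a : merging) : part := fold_closure d (merged a).

Definition merge_weight (n : nat) (a : merging) : algC :=
  (\prod_p vweight n #|a.1 p|) * (\prod_e eweight n #|a.2 e|).

Definition euler_pow (n : nat) (d : part) : algC := n%:R ^+ #|verts d| / n%:R ^+ #|edges d|.

(** The coefficient called R_h above. *)
Definition merge_coef (n : nat) (h : part) : algC :=
  \sum_(d : part | core_graph d) \sum_(a | valid d a && (merge_closure d a == h))
    euler_pow n d * merge_weight n a.

Lemma prec_card (A B : finType) (S : {set A}) (f : A -> B) a :
  a \in S -> (#|prec S f a| < #|S|)%N.
Proof.
move=> aS; apply: proper_card; apply/properP; split.
  by apply/subsetP=> b; rewrite inE => /andP[].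
by exists a => //; rewrite inE ltnn /= andbF.
Qed.

Lemma card_edges_le (d : part) : (#|edges d| <= l)%N.
Proof. by apply: leq_trans (leq_imset_card _ _) _; rewrite card_ord. Qed.

Lemma card_verts_le (d : part) : (#|verts d| <= l.+1)%N.
Proof. by apply: leq_trans (leq_imset_card _ _) _; rewrite card_ord. Qed.

Section Fixn.
Variable n : nat.
Hypotheses (n0 : (0 < n)%N) (ln : (l <= n)%N).

Let nz : n%:R != 0 :> algC. Proof. by rewrite pnatr_eq0 -lt0n. Qed.

(** The base graph [g] enters only through the condition that it is coarser
    than the closure of the merges. *)
Lemma respects_compat (d g : part) (a : merging) : core_graph g -> refines d g ->
  respects g a.1 && respects (coarsen g) a.2 = same_gen a && refines (merge_closure d a) g.
Proof.
move=> /and3P[_ gf _] dg; rewrite /merge_closure -compat_fold_closure // /compat gf dg /=.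
apply/andP/andP=> [[/forallP r1 /forallP r2]|[/forallP sg /forall_inP cg]]; split.
- apply/forallP=> e; apply/forall_inP=> e' /(forall_inP (r2 e)).
  by rewrite -pair_eqE => /andP[].
- apply/forall_inP=> u; rewrite !inE => /orP[/(forall_inP (r1 u.1))|]; first by rewrite eq_sym.
  case/imsetP=> -[e e']; rewrite inE /= => /(forall_inP (r2 e)).
  by rewrite -pair_eqE eq_sym => /andP[_ ?] ->.
- apply/forallP=> p; apply/forall_inP=> q qp; rewrite eq_sym; apply: (cg (p, q)).
  by rewrite !inE qp.
- apply/forallP=> e; apply/forall_inP=> e' e'e; rewrite -pair_eqE; apply/andP; split.
    by rewrite /=; have /forall_inP H := sg e; apply: H.
  rewrite eq_sym /=; apply: (cg (e.2, e'.2)); rewrite !inE; apply/orP; right.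
  by apply/imsetP; exists (e, e'); rewrite ?inE.
Qed.

(** The hypothesis [l <= n] keeps all denominators positive. *)
Lemma lift_weight_expand (d g : part) : core_graph g -> refines d g ->
  lift_weight n d g =
  \sum_(a | valid d a && refines (merge_closure d a) g) euler_pow n d * merge_weight n a.
Proof.
move=> gc dg.
have e1 : \prod_(v in verts d) (n - #|prec (verts d) g v|)%:R =
    n%:R ^+ #|verts d| * \prod_(v in verts d)
      (\sum_(X : {set P} | X \subset prec (verts d) g v) vweight n #|X|) :> algC.
  rewrite -prodr_const -big_split /=; apply: eq_bigr => v vd.
  rewrite sum_subset_card sum_vweight // mulrC divfK // natrB //.
  by apply: leq_trans ln; rewrite -ltnS (leq_trans (prec_card g vd)) ?card_verts_le.
have e2 : (\prod_(e in edges d) (n - #|prec (edges d) (coarsen g) e|)%:R)^-1 =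
    (n%:R ^+ #|edges d|)^-1 * \prod_(e in edges d)
      (\sum_(X : {set U} | X \subset prec (edges d) (coarsen g) e) eweight n #|X|) :> algC.
  rewrite -prodr_const -!prodfV -big_split /=; apply: eq_bigr => e ed.
  rewrite sum_subset_card sum_eweight ?mulKf //.
  by apply: leq_trans (prec_card _ ed) (leq_trans (card_edges_le d) ln).
rewrite /lift_weight e1 e2 mulrACA -/(euler_pow n d) -mulr_sumr; congr (_ * _).
rewrite !expand_prec // ?/eweight ?ffactn0 ?divr1 // big_distrlr /= pair_big /=.
apply: eq_bigl => -[F H] /=; rewrite /valid /= -!andbA.
have := respects_compat (F, H) gc dg => /= <-.
by case: (admissible _ F); case: (admissible _ H); rewrite ?andbF.
Qed.

Definition lift_sum (g : part) : algC :=
  \sum_(d | core_graph d && refines d g) lift_weight n d g.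

Lemma refines_merge_closure (d : part) a : refines d (merge_closure d a).
Proof. by have /and3P[] := fold_closure_compat d (merged a). Qed.

Lemma lift_sum_merge_coef (g : part) : core_graph g ->
  lift_sum g = \sum_(h | core_graph h && refines h g) merge_coef n h.
Proof.
move=> gc; rewrite exchange_big /=.
transitivity (\sum_(d | core_graph d)
  \sum_(a | valid d a && refines (merge_closure d a) g) euler_pow n d * merge_weight n a).
  rewrite /lift_sum [RHS](bigID (fun d => refines d g)) /=.
  rewrite [X in _ + X]big1 ?addr0 => [|d /andP[_ dg]].
    by apply: eq_bigr => d /andP[_ dg]; rewrite lift_weight_expand.
  rewrite big_pred0 // => a; apply: contraNF dg => /andP[_].
  exact: refines_trans (refines_merge_closure _ _).
apply: eq_bigr => d dc.
rewrite (partition_big (merge_closure d) (fun h => core_graph h && refines h g)) /=; last first.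
  by move=> a /andP[_ ->]; rewrite andbT; apply: fold_closure_core; have /and3P[] := dc.
apply: eq_bigr => h /andP[_ hg]; apply: eq_bigl => a; rewrite -andbA; congr (_ && _).
by case: eqP => [->|]; rewrite ?hg ?andbF.
Qed.

Definition term_weight (a : merging) : nat :=
  (\prod_p wbound #|a.1 p|) * (\prod_e wbound #|a.2 e|).

Lemma merge_weight_bound a : `|merge_weight n a| <= (term_weight a)%:R / n%:R ^+ merging_size a.
Proof.
rewrite normrM natrM exprD invfM mulrACA.
apply: ler_pM; rewrite ?normr_ge0 //; apply: prod_weight_bound => s.
  exact: vweight_bound.
exact: eweight_bound.
Qed.

Let n1 : 1 <= n%:R :> algC. Proof. by rewrite ler1n. Qed.
Let nX k : 0 < n%:R ^+ k :> algC. Proof. by rewrite exprn_gt0 // ltr0n. Qed.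

Lemma euler_pow_ge0 d : 0 <= euler_pow n d.
Proof. by rewrite divr_ge0 ?exprn_ge0 ?ler0n. Qed.

Lemma euler_pow_merge (d d' : part) s :
  (#|edges d'| + #|verts d| <= #|edges d| + #|verts d'| + s)%N ->
  euler_pow n d / n%:R ^+ s <= euler_pow n d'.
Proof.
move=> H; rewrite /euler_pow -mulrA -invfM -exprD ler_pdivrMr // mulrAC ler_pdivlMr //.
by rewrite -!exprD; apply: ler_weXn2l => //; lia.
Qed.

(** The cost of the merges compensates the increase of the rank. *)
Lemma term_bound (d : part) a : core_graph d ->
  `|euler_pow n d * merge_weight n a| <= (term_weight a)%:R * euler_pow n (merge_closure d a).
Proof.
case/and3P=> /eqP dcan df _.
rewrite normrM ger0_norm ?euler_pow_ge0 //.
apply: le_trans (ler_wpM2l (euler_pow_ge0 d) (merge_weight_bound a)) _.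
rewrite mulrCA ler_wpM2l ?ler0n // euler_pow_merge //.
apply: leq_trans (rank_fold_closure (merged a) dcan df) _.
by rewrite leq_add2l card_merged.
Qed.

Definition total_bound : nat := \sum_(d : part) \sum_(a : merging) term_weight a.

Lemma merge_coef_bound (h : part) : `|merge_coef n h| <= total_bound%:R * euler_pow n h.
Proof.
apply: le_trans (ler_norm_sum _ _ _) _.
rewrite /total_bound natr_sum mulr_suml big_mkcond /=; apply: ler_sum => d _.
case: ifP => dc; last by rewrite mulr_ge0 ?euler_pow_ge0 ?ler0n.
apply: le_trans (ler_norm_sum _ _ _) _.
rewrite natr_sum mulr_suml big_mkcond /=; apply: ler_sum => a _.
case: ifP => [/andP[_ /eqP <-]|_]; last by rewrite mulr_ge0 ?euler_pow_ge0 ?ler0n.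
exact: term_bound.
Qed.

Lemma lift_weight_bound (d g : part) : core_graph d -> core_graph g -> refines d g ->
  `|lift_weight n d g| <= total_bound%:R * euler_pow n d.
Proof.
move=> dc gc dg; rewrite lift_weight_expand // -mulr_sumr normrM ger0_norm ?euler_pow_ge0 //.
rewrite mulrC ler_wpM2r ?euler_pow_ge0 //.
apply: le_trans (ler_norm_sum _ _ _) _.
apply: (@le_trans _ _ (\sum_(a : merging) (term_weight a)%:R)).
  rewrite big_mkcond /=; apply: ler_sum => a _; case: ifP => _; last by rewrite ler0n.
  apply: le_trans (merge_weight_bound a) _.
  by rewrite ler_pdivrMr // ler_peMr ?ler0n // exprn_ege1.
by rewrite -natr_sum ler_nat /total_bound (bigD1 d) //= leq_addr.
Qed.

End Fixn.
End Expand.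

(** * Decay in terms of the primitivity rank *)

Lemma mean_fix n : (0 < n)%N ->
  mean (fun s : 'S_n => (#|[set i | s i == i]|%:R : algC)) = 1.
Proof.
move=> n0; rewrite /mean.
have -> : \sum_(s : 'S_n) (#|[set i | s i == i]|%:R : algC) = (n * n.-1`!)%:R.
  rewrite -natr_sum; congr _%:R.
  rewrite (eq_bigr (fun s : 'S_n => \sum_(i | s i == i) 1)%N) => [|s _]; last first.
    by rewrite sum1dep_card.
  rewrite (exchange_big_dep xpredT) //= (eq_bigr (fun=> n.-1`!)) => [|i _].
    by rewrite sum_nat_const card_ord.
  rewrite sum1dep_card -subn1 -[in RHS](card_ord n) -(cards1 i).
  rewrite -(card_perm_extend (f := id)) //; apply: eq_card => s; rewrite !inE.
  apply/idP/forall_inP => [si x|]; last by apply; rewrite inE.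
  by rewrite inE => /eqP->.
have -> : (n * n.-1`! = n`!)%N by case: n n0.
by rewrite card_Sn divff // pnatr_eq0 -lt0n fact_gt0.
Qed.

Section Levels.
Variables (r : nat) (w : freegroup 'I_r).
Notation l := (size w).
Notation P := 'I_l.+1.
Notation U := ('I_r * P)%type.
Notation part := {ffun P -> P}.
Implicit Types (d g h : part).

Lemma word_value_fst (K : groupType) (T : finType) (V : Type)
    (x : V -> perm_wreath K T) (u : 'I_l -> V) :
  (word_value x u).1 = word_value (fun v => (x v).1) u.
Proof.
rewrite /word_value (big_morph (fun a : perm_wreath K T => a.1)
  (id1 := 1%g) (op1 := fun a b => (a * b)%g)) //.
by apply: eq_bigr => j _; case: (sgn j).
Qed.

(** The wreath product formula for the constant character. *)
Lemma mean_fix_lift_sum n g : (0 < n)%N -> (l <= n)%N -> core_graph g ->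
  mean (fun s : {ffun U -> 'S_n} =>
    (#|[set i | word_value s (edge g) i == i]|%:R : algC)) = lift_sum n g.
Proof.
move=> n0 ln gc.
have := @wreath_formula r w 'I_n g gc; rewrite card_ord => /(_ ln n0 'S_n (fun=> 1)) e.
transitivity (\sum_(d | core_graph d && refines d g)
  lift_weight n d g * core_mean (fun _ : 'S_n => 1) d).
  rewrite -e; apply: eq_mean => s /=.
  rewrite -[LHS](@mean_const {ffun U * 'I_n -> 'S_n}); last first.
    by apply/card_gt0P; exists [ffun=> 1%g].
  apply: eq_mean => y; rewrite sumr_const; congr (_ *+ _); apply: eq_card => i.
  by rewrite inE unfold_in word_value_fst.
apply: eq_bigr => d _; rewrite /core_mean mean_const ?mulr1 //.
by apply/card_gt0P; exists [ffun=> 1%g].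
Qed.

Definition uniform g := forall (G : finGroupType) (chi : G -> algC), core_mean chi g = mean chi.

Lemma uniform_lift_sum n g : (0 < n)%N -> (l <= n)%N ->
  core_graph g -> uniform g -> lift_sum n g = 1.
Proof.
move=> n0 ln gc gu; rewrite -mean_fix_lift_sum // -[RHS](mean_fix n0).
exact: (gu _ (fun s : 'S_n => #|[set i | s i == i]|%:R)).
Qed.

Hypothesis w1 : w <> 1%g.

Definition rank_pow n := pow_1_sub n%:R (primitivity_rank w).

(** A fundamental group of rank 0 is trivial, so that w would be 1. *)
Lemma rank_gt0 g : core_graph g -> (#|verts g| <= #|edges g|)%N.
Proof.
move=> gc; rewrite -ltnS -(card_cotree gc) -[X in (X < _)%N]add0n ltn_add2r lt0n.
apply: contra_notN w1 => /eqP c0.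
rewrite -(loop_embed_word gc) /loop_embed (_ : loop_word g = 1%g) ?fg_lift1 //.
apply/val_inj; case: (loop_word g) => [[|[i b] s]] //= _.
by have : (i < 0)%N by rewrite -[X in (_ < X)%N]c0 ltn_ord.
Qed.

Lemma primitivity_rank_le k : nonprimitive_rank w k ->
  exists2 k0, primitivity_rank w = Some k0 & (k0 <= k)%N.
Proof.
move=> wk; rewrite /primitivity_rank; case: pselect => [ex|ne].
  by exists (ex_minn ex) => //; case: ex_minnP => m _; apply; apply/asboolP.
by case: ne; exists k; apply/asboolP.
Qed.

Lemma primitivity_rank_gt0 k : primitivity_rank w = Some k -> (0 < k)%N.
Proof.
rewrite /primitivity_rank; case: pselect => // ex [<-]; case: ex_minnP => -[|m] //.
move=> /asboolP[H [_ [b [_ bH]] Hw _]] _; case: w1.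
have [u <-] := (bH w).1 Hw; rewrite (_ : u = 1%g) ?fg_lift1 //.
by apply/val_inj; case: u => [[|[[i]]]].
Qed.

Lemma rank_pow_ge0 n : 0 <= rank_pow n.
Proof.
by rewrite /rank_pow /pow_1_sub; case: primitivity_rank => // k; rewrite exprz_ge0 ?ler0n.
Qed.

Lemma rank_powE n k : (0 < n)%N -> primitivity_rank w = Some k ->
  rank_pow n = (n%:R ^+ k.-1)^-1.
Proof.
move=> n0 wk; rewrite /rank_pow wk /=.
have := primitivity_rank_gt0 wk; case: k {wk} => // k _ /=.
rewrite (_ : 1 - k.+1%:Z = - k%:Z); last by rewrite intS; ring.
by rewrite -exprnN.
Qed.

Lemma rank_pow_le1 n : (0 < n)%N -> rank_pow n <= 1.
Proof.
move=> n0; case wk : (primitivity_rank w) => [k|]; last by rewrite /rank_pow wk ler01.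
by rewrite (rank_powE n0 wk) invf_le1 ?exprn_gt0 ?ltr0n // exprn_ege1 // ler1n.
Qed.

Lemma rank_powM n m : rank_pow (n * m) = rank_pow n * rank_pow m.
Proof.
rewrite /rank_pow /pow_1_sub; case: primitivity_rank => [k|]; last by rewrite mul0r.
by rewrite natrM expfzMl.
Qed.

Lemma rank_or_uniform g : core_graph g ->
  uniform g \/ (forall n, (0 < n)%N -> euler_pow n g <= rank_pow n).
Proof.
move=> gc; case: (primitive_or_rank gc) => [wk|]; [right => n n0|by left].
have [k0 wk0 kk] := primitivity_rank_le wk; rewrite (rank_powE n0 wk0) /euler_pow.
have k0gt := primitivity_rank_gt0 wk0; have ck := card_cotree gc.
have nX k : 0 < n%:R ^+ k :> algC by rewrite exprn_gt0 // ltr0n.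
rewrite ler_pdivrMr // mulrC ler_pdivlMr // -exprD ler_weXn2l ?ler1n //.
by clear -k0gt ck kk; lia.
Qed.

Lemma euler_pow_le1 n g : (0 < n)%N -> core_graph g -> euler_pow n g <= 1.
Proof.
move=> n0 gc; rewrite /euler_pow ler_pdivrMr ?exprn_gt0 ?ltr0n // mul1r.
by apply: ler_weXn2l; rewrite ?ler1n // rank_gt0.
Qed.


Definition discrete : part := [ffun p => p].

Lemma discrete_canon : canon discrete = discrete.
Proof. by apply/ffunP=> p; rewrite -[RHS]canonK /discrete !ffunE. Qed.

(** This is where w is reduced: distinct positions can only be forced to
    coincide by two adjacent cancelling letters. *)
Lemma discrete_folded : folded discrete.
Proof.
have adj (j k : 'I_l) : k = j.+1 :> nat -> gen k = gen j -> sgn k = ~~ sgn j -> False.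
  move=> kj ge se; have := freegroupP w; rewrite /reduced => /(sortedP (letter j)) red.
  have nE (i : 'I_l) : nth (letter j) w i = letter i by apply: esym; apply: tnth_nth.
  have := red j; rewrite -kj ltn_ord !nE => /(_ isT) /eqP; apply.
  by rewrite /letter_inv [LHS]surjective_pairing -/(gen k) -/(sgn k) ge se.
apply/foldedP=> j k ge; rewrite !ffunE /src /tgt -!val_eqE.
case sj: (sgn j); case sk: (sgn k); rewrite /= /bump /= ?add1n ?eqSS //.
  apply/eqP/eqP => e; exfalso.
    by apply: (adj j k); rewrite ?sj ?sk // -e.
  by apply: (adj k j); rewrite ?sj ?sk // e.
apply/eqP/eqP => e; exfalso.
  by apply: (adj k j); rewrite ?sj ?sk // e.
by apply: (adj j k); rewrite ?sj ?sk // -e.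
Qed.

(** The finest core graph, obtained from a segment by joining its ends. *)
Definition base : part := fold_closure discrete [set (ord0, ord_max)].

Lemma base_core_graph : core_graph base.
Proof.
have /and3P[bf _ /forall_inP bc] := fold_closure_compat discrete [set (ord0, ord_max)].
rewrite /core_graph fold_closure_canon eqxx bf /=; apply: (bc (ord0, ord_max)); exact: set11.
Qed.

(** A segment has rank 0 and one merge is performed. *)
Lemma base_rank : (#|edges base| <= #|verts base|)%N.
Proof.
have := rank_fold_closure [set (ord0, ord_max)] discrete_canon discrete_folded.
rewrite cards1 -/base (_ : #|verts discrete| = l.+1).
  rewrite addnS addn1 ltnS => h.
  have := leq_trans h (leq_add (card_edges_le discrete) (leqnn _)).
  by rewrite addnC leq_add2l.
rewrite -[RHS]card_ord -cardsT; congr #|pred_of_set _|; apply/setP=> p.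
by rewrite (vertsP _ discrete_canon) ffunE eqxx inE.
Qed.

Lemma base_refines h : core_graph h -> refines base h.
Proof.
case/and3P=> _ hf hc; apply: fold_closure_min; apply/and3P; split=> //.
  by apply/refinesP=> p q; rewrite !ffunE => ->.
by apply/forall_inP=> u; rewrite inE => /eqP->.
Qed.

Lemma base_unique h : core_graph h -> refines h base -> h = base.
Proof.
move=> hc hb; apply: refines_anti => //; last exact: base_refines.
  by have /and3P[/eqP] := hc.
exact: fold_closure_canon.
Qed.

Lemma merge_coef_base n : uniform base -> (0 < n)%N -> (l <= n)%N -> merge_coef n base = 1.
Proof.
move=> bu n0 ln; rewrite -(uniform_lift_sum n0 ln base_core_graph bu).
rewrite lift_sum_merge_coef //; last exact: base_core_graph.
rewrite (big_pred1 base) // => h; apply/andP/eqP => [[hc]|->]; first exact: base_unique.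
by rewrite base_core_graph refines_refl.
Qed.

(** Induction on the number of refinements of [h].  If w is not primitive in
    [h] then the rank of [h] is large enough; otherwise the coefficients of the
    refinements of [h] add up to 1, which is already the coefficient of
    [base], and those strictly between are known to be small. *)
Lemma merge_coef_small : uniform base -> exists2 C : algC, 0 <= C &
  forall h, core_graph h -> h != base -> forall n, (0 < n)%N -> (l <= n)%N ->
  `|merge_coef n h | <= C * rank_pow n.
Proof.
move=> bu.
pose N h := #|[set h' : part | core_graph h' && refines h' h]|.
have claim m : exists2 C : algC, 0 <= C &
    forall h, (N h <= m)%N -> core_graph h -> h != base -> forall n, (0 < n)%N -> (l <= n)%N ->
    `|merge_coef n h | <= C * rank_pow n.
  elim: m => [|m [C C0 IH]].
    exists 0 => // h; rewrite leqn0 cards_eq0 => /eqP /setP/(_ h).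
    by rewrite !inE refines_refl andbT => ->.
  exists ((total_bound w)%:R + C *+ #|{: part}|); first by rewrite addr_ge0 ?ler0n ?mulrn_wge0.
  move=> h Nh hc hb n n0 ln.
  have [hu|/(_ n n0) hr] := rank_or_uniform hc; last first.
    apply: le_trans (merge_coef_bound n0 ln h) _.
    apply: le_trans (ler_wpM2l _ hr) _; rewrite ?ler0n //.
    by rewrite ler_wpM2r ?rank_pow_ge0 // lerDl mulrn_wge0.
  have := uniform_lift_sum n0 ln hc hu; rewrite lift_sum_merge_coef //.
  rewrite (bigD1 base) /=; last by rewrite base_core_graph base_refines.
  rewrite (bigD1 h) /=; last by rewrite hc refines_refl.
  rewrite merge_coef_base // -[X in _ = X]addr0 => /addrI/eqP; rewrite addr_eq0 => /eqP->.
  rewrite normrN; apply: le_trans (ler_norm_sum _ _ _) _.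
  apply: (@le_trans _ _ (C *+ #|{: part}| * rank_pow n)); last first.
    by rewrite ler_wpM2r ?rank_pow_ge0 // lerDr ler0n.
  rewrite mulrnAl -sumr_const big_mkcond /=; apply: ler_sum => h' _.
  case: ifP => [|_]; last by rewrite mulr_ge0 ?rank_pow_ge0.
  case/andP=> /andP[/andP[h'c h'h] h'b] h'nh; apply: IH => //.
  rewrite -ltnS; apply: leq_trans Nh; apply: proper_card; apply/properP; split.
    by apply/subsetP=> d; rewrite !inE => /andP[-> /refines_trans]; apply.
  exists h; rewrite !inE hc ?refines_refl //=; apply: contra h'nh => hh'.
  by apply/eqP/refines_anti => //; [have /and3P[/eqP] := h'c | have /and3P[/eqP] := hc].
have [C C0 H] := claim #|{: part}|; exists C => // h; apply: H; exact: max_card.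
Qed.

(** If w is not primitive in [base], whose rank is at most one, then the bound
    is at least 1 and it suffices that the expectation is bounded. *)
Lemma lift_sum_near1 : exists2 C : algC, 0 <= C &
  forall n g, (0 < n)%N -> (l <= n)%N -> core_graph g -> `|lift_sum n g - 1| <= C * rank_pow n.
Proof.
have [bu|br] := rank_or_uniform base_core_graph.
  have [C C0 H] := merge_coef_small bu.
  exists (C *+ #|{: part}|); first by rewrite mulrn_wge0.
  move=> n g n0 ln gc; rewrite lift_sum_merge_coef // (bigD1 base) /=; last first.
    by rewrite base_core_graph base_refines.
  rewrite merge_coef_base //.
  rewrite addrAC subrr add0r; apply: le_trans (ler_norm_sum _ _ _) _.
  rewrite mulrnAl -sumr_const big_mkcond /=; apply: ler_sum => h _.
  case: ifP => [/andP[/andP[hc _] hb]|_]; first exact: H.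
  by rewrite mulr_ge0 ?rank_pow_ge0.
exists ((total_bound w)%:R *+ #|{: part}| + 1).
  by rewrite addr_ge0 ?mulrn_wge0 ?ler0n ?ler01.
move=> n g n0 ln gc.
have pw1 : 1 <= rank_pow n.
  apply: le_trans (br n n0); rewrite /euler_pow ler_pdivlMr ?exprn_gt0 ?ltr0n // mul1r.
  by apply: ler_weXn2l; rewrite ?ler1n // base_rank.
apply: le_trans (ler_normB _ _) _; rewrite normr1.
rewrite mulrDl mul1r; apply: lerD => //.
apply: (@le_trans _ _ ((total_bound w)%:R *+ #|{: part}|)); last first.
  by rewrite ler_peMr ?mulrn_wge0 ?ler0n.
rewrite lift_sum_merge_coef //; apply: le_trans (ler_norm_sum _ _ _) _.
rewrite -sumr_const big_mkcond /=; apply: ler_sum => h _.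
case: ifP => [/andP[hc _]|_]; last by rewrite ler0n.
apply: le_trans (merge_coef_bound n0 ln h) _.
by rewrite ler_piMr ?ler0n // euler_pow_le1.
Qed.

(** The terms in which w is primitive vanish, and in the others the number of
    lifts is at most of the required order. *)
Lemma level_step : exists2 D : algC, 0 <= D &
  forall n (phi : part -> algC) (B : algC), (0 < n)%N -> (l <= n)%N -> 
  (forall d, core_graph d -> uniform d -> phi d = 1) ->
  (forall d, core_graph d -> `|phi d - 1| <= B) ->
  forall g, core_graph g ->
  `|\sum_(d | core_graph d && refines d g) lift_weight n d g * phi d - lift_sum n g|
    <= D * B * rank_pow n.
Proof.
exists ((total_bound w)%:R *+ #|{: part}|); first by rewrite mulrn_wge0 ?ler0n.
move=> n phi B n0 ln phiu phiB g gc.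
have B0 : 0 <= B by apply: le_trans (phiB g gc).
rewrite /lift_sum -sumrB; apply: le_trans (ler_norm_sum _ _ _) _.
have KB0 : 0 <= (total_bound w)%:R * B * rank_pow n.
  by apply: mulr_ge0; [apply: mulr_ge0; rewrite ?ler0n | apply: rank_pow_ge0].
rewrite 2!mulrnAl -sumr_const big_mkcond /=; apply: ler_sum => d _.
case: ifP => [/andP[dc dg]|//].
rewrite -[X in _ - X]mulr1 -mulrBr normrM.
have [du|/(_ n n0) dr] := rank_or_uniform dc.
  by rewrite phiu // subrr normr0 mulr0.
rewrite mulrAC; apply: ler_pM; rewrite ?normr_ge0 ?phiB //.
apply: le_trans (lift_weight_bound n0 ln dc gc dg) _.
by rewrite ler_wpM2l ?ler0n.
Qed.

(** The properties shared by the expectations [phi k g] over the successive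
    levels of the tree. *)
Definition tower m (n : nat -> nat) (phi : nat -> part -> algC) :=
  [/\ forall i, (1 <= i <= m)%N -> (0 < n i)%N /\ (l <= n i)%N,
      forall d, core_graph d -> phi 0 d = 1,
      forall k d, (k <= m)%N -> core_graph d -> uniform d -> phi k d = 1 &
      forall k g, (k < m)%N -> core_graph g ->
        phi k.+1 g = \sum_(d | core_graph d && refines d g) lift_weight (n k.+1) d g * phi k d].

Lemma tower_step m k (B : algC) : 0 <= B -> (k < m)%N -> exists2 C : algC, 0 <= C &
  forall n phi, tower m n phi -> (forall d, core_graph d -> `|phi k d - 1| <= B) ->
  forall g, core_graph g -> `|phi k.+1 g - 1| <= C * rank_pow (n k.+1).
Proof.
have [D D0 HD] := level_step; have [E E0 HE] := lift_sum_near1.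
move=> B0 km; exists (D * B + E); first by rewrite addr_ge0 ?mulr_ge0.
move=> n phi [nok _ phiu phiS] phiB g gc.
have [n0 ln] := nok k.+1 km.
rewrite -(subrKA (lift_sum (n k.+1) g)) mulrDl; apply: le_trans (ler_normD _ _) _.
apply: lerD; last exact: HE.
by rewrite phiS //; apply: HD => // d; apply: phiu; apply: ltnW.
Qed.

Lemma tower_near1 m k : (k < m)%N -> exists2 C : algC, 0 <= C &
  forall n phi, tower m n phi -> forall g, core_graph g ->
    `|phi k.+1 g - 1| <= C * rank_pow (n k.+1).
Proof.
elim: k => [|k IHk] km.
  have [C C0 HC] := tower_step (lexx 0) km; exists C => // n phi tw; apply: HC => //.
  by case: tw => _ p0 _ _ d dc; rewrite p0 // subrr normr0.
have [B B0 HB] := IHk (ltnW km); have [C C0 HC] := tower_step B0 km.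
exists C => // n phi tw; apply: HC => // d dc; apply: le_trans (HB _ _ tw _ dc) _.
have [nok _ _ _] := tw; have [n0 _] := nok k.+1 (ltnW km).
by rewrite ler_piMr // rank_pow_le1.
Qed.

Lemma tower_close k : exists2 C : algC, 0 <= C &
  forall n phi, tower k.+2 n phi -> forall g, core_graph g ->
    `|phi k.+2 g - lift_sum (n k.+2) g| <= C * rank_pow (n k.+1 * n k.+2).
Proof.
have [D D0 HD] := level_step; have [B B0 HB] := @tower_near1 k.+2 k (ltnW (ltnSn _)).
exists (D * B); first exact: mulr_ge0.
move=> n phi tw g gc; have [nok _ phiu phiS] := tw.
have [n0 ln] := nok k.+2 (leqnn _).
rewrite rank_powM mulrA -[D * B * _]mulrA phiS //; apply: HD => // d dc.
  by apply: phiu => //; apply: ltnW.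
exact: HB.
Qed.

End Levels.

(** * One level of the tree *)

Lemma mean_pair (A B : finType) (F : A -> B -> algC) :
  mean (fun p : A * B => F p.1 p.2) = mean (fun a => mean (F a)).
Proof.
rewrite /mean -mulr_suml pair_big /= card_prod mulnC natrM invfM mulrA; congr (_ / _ / _).
Qed.

Section WreathTree.
Variables (n : nat -> nat) (k : nat).
Notation S := (subg_of (tree_aut_group n k)).
Notation S' := (subg_of (tree_aut_group n k.+1)).
Notation N := (n k.+1).
Notation W := (wreath S N).
Hypothesis N0 : (0 < N)%N.

Let f := sgval_morphism (tree_aut_group n k).

Lemma wreath_tree_im : (wreath_perm_morphism f @* [set: W] = tree_aut n k.+1)%g.
Proof.
apply: wreath_perm_im; first exact: injm_sgval.
by rewrite im_sgval.
Qed.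

Lemma wreath_tree_inj : injective (wreath_perm f).
Proof.
have /injmP H := wreath_perm_injm (injm_sgval (tree_aut_group n k)).
by move=> x y; apply: H; rewrite inE.
Qed.

Definition wtree (p : W) : S' := subg (tree_aut_group n k.+1) (wreath_perm f p).

Lemma wtreeE p : sgval (wtree p) = wreath_perm f p.
Proof.
rewrite /wtree subgK // -[_ \in _]/(_ \in tree_aut n k.+1) -wreath_tree_im.
by apply: mem_morphim; rewrite inE.
Qed.

Lemma wtreeM : {morph wtree : p q / (p * q)%g}.
Proof.
move=> p q; apply: val_inj; rewrite /= !wtreeE.
by rewrite (wreath_permM f) ?inE.
Qed.

Lemma wtree_bij : bijective wtree.
Proof.
apply: inj_card_bij.
  by move=> p q e; apply: wreath_tree_inj; rewrite -!wtreeE e.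
rewrite -cardsT -(card_injm (injm_sgval (tree_aut_group n k.+1)) (subxx _)) im_sgval.
rewrite -[X in (X <= _)%N]/#|tree_aut n k.+1| -wreath_tree_im morphimEdom.
by apply: leq_trans (leq_imset_card _ _) _; rewrite cardsT.
Qed.

(** The wreath product of the tree indexes labels by the target of the
    permutation, [perm_wreath] by the source. *)
Definition labels (p : W) : perm_wreath S 'I_N := (p.1, [ffun i => p.2 (p.1 i)]).

Lemma labelsM : {morph labels : p q / (p * q)%g}.
Proof.
move=> p q; congr pair; apply/ffunP=> i; rewrite !ffunE /= ?ffunE permM permK.
by [].
Qed.

Lemma wreath_in (s : 'S_N) (y : {ffun 'I_N -> S}) :
  (s, [ffun j => y ((s^-1)%g j)] : {dffun 'I_N -> S})
    \in setX [set: 'S_N] [set: {dffun 'I_N -> S}].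
Proof. by rewrite !inE. Qed.

Definition of_labels (s : 'S_N) (y : {ffun 'I_N -> S}) : W := SdPair _ (wreath_in s y).

Lemma labelsK p : of_labels (labels p).1 (labels p).2 = p.
Proof.
apply: val_inj; case: p => -[s y] sy /=; congr pair.
by apply/ffunP=> j; rewrite !ffunE /= permKV.
Qed.

Lemma of_labelsK s y : labels (of_labels s y) = (s, y).
Proof.
by congr pair; apply/ffunP=> i; rewrite !ffunE /= permK.
Qed.

Definition fixed_leaves (m : nat) (x : subg_of (tree_aut_group n m)) : algC :=
  perm_character 'P (leaves n m) (sgval x).

Lemma leafE (v : vertex n k.+1) :
  (v \in leaves n k.+1) = if v is Some (_, u) then u \in leaves n k else false.
Proof.
case: v => [[i u]|]; rewrite !inE.
  apply/forallP/forallP => [H v|H [[j v]|]] //; last by rewrite negb_and (H v) orbT.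
  by have := H (Some (i, v)); rewrite /= eqxx.
by apply/negP=> /forallP/(_ (Some (Ordinal N0, tree_root n k))); rewrite /= eqxx.
Qed.

Lemma in_fixed_points (T : finType) (D : {set T}) (s : {perm T}) v :
  (v \in 'Fix_(D | 'P)[s])%g = (v \in D) && (s v == v).
Proof. by rewrite in_setI; congr (_ && _); apply/afix1P/eqP. Qed.

Lemma fixed_leaves_wreath (p : W) :
  fixed_leaves (wtree p) = \sum_(i | (labels p).1 i == i) fixed_leaves ((labels p).2 i).
Proof.
rewrite /fixed_leaves /perm_character wtreeE -natr_sum; congr _%:R.
pose B := [set q : 'I_N * vertex n k | ((labels p).1 q.1 == q.1) &&
   (q.2 \in 'Fix_(leaves n k | 'P)[sgval ((labels p).2 q.1)])%g].
transitivity #|Some @: B|.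
  apply: eq_card => v; rewrite in_fixed_points leafE wreath_permE.
  apply/andP/imsetP => [|[[i u]]].
    case: v => [[i u]|] [] // ul /eqP [e1 e2]; exists (i, u) => //.
    by rewrite inE in_fixed_points /= ffunE e2 ul e1 !eqxx.
  by rewrite inE in_fixed_points /= ffunE => /and3P[/eqP e1 ul /eqP e2] ->; rewrite ul /= e2 e1.
rewrite (card_imset _ (@Some_inj _)) -sum1_card.
rewrite (eq_bigl (fun q : 'I_N * vertex n k => ((labels p).1 q.1 == q.1) &&
   (q.2 \in 'Fix_(leaves n k | 'P)[sgval ((labels p).2 q.1)])%g)) => [|q]; last by rewrite inE.
rewrite -(pair_big_dep (fun i => (labels p).1 i == i)
  (fun i u => u \in 'Fix_(leaves n k | 'P)[sgval ((labels p).2 i)])%g (fun _ _ => 1%N)) /=.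
by apply: eq_bigr => i _; rewrite sum1_card.
Qed.

(** On average one child of the root is fixed, and below a fixed child one
    leaf is fixed on average. *)
Lemma mean_fixed_leaves : mean (@fixed_leaves k) = 1 -> mean (@fixed_leaves k.+1) = 1.
Proof.
move=> IH; rewrite -(mean_bij _ wtree_bij).
have lab_bij : bijective (fun q : 'S_N * {ffun 'I_N -> S} => of_labels q.1 q.2).
  by exists labels => [[s y]|p]; [exact: of_labelsK | exact: labelsK].
rewrite -(mean_bij _ lab_bij).
rewrite -[RHS](mean_fix N0) (mean_pair (fun s y => fixed_leaves (wtree (of_labels s y)))).
apply: eq_mean => s.
rewrite (eq_mean (F' := fun y : {ffun 'I_N -> S} =>
    \sum_(i | s i == i) fixed_leaves (y i))) => [|y]; last first.
  by rewrite fixed_leaves_wreath of_labelsK.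
rewrite /mean exchange_big /= mulr_suml.
rewrite (eq_bigr (fun=> 1)) => [|i _].
  by rewrite sumr_const; congr (_ *+ _); apply: eq_card => i; rewrite inE.
have := @mean_ffun_inj _ unit 'I_N (fun=> i) (fun z : {ffun unit -> S} => fixed_leaves (z tt)).
rewrite /mean => e; rewrite -[RHS]IH.
transitivity ((\sum_(z : {ffun unit -> S}) fixed_leaves (z tt)) / #|{ffun unit -> S}|%:R).
  by rewrite -e => [|[] []] //; congr (_ / _); apply: eq_bigr => y _; rewrite ffunE.
have ubij : bijective (fun x : S => [ffun _ : unit => x]).
  exists (fun z : {ffun unit -> S} => z tt) => [x|z]; first by rewrite ffunE.
  by apply/ffunP=> -[]; rewrite ffunE.
have := mean_bij (fun z : {ffun unit -> S} => fixed_leaves (z tt)) ubij; rewrite /mean => <-.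
by congr (_ / _); apply: eq_bigr => x _; rewrite ffunE.
Qed.

Lemma core_mean_level (r : nat) (w : seq ('I_r * bool))
    (g : {ffun 'I_(size w).+1 -> 'I_(size w).+1}) :
  (size w <= N)%N -> core_graph g ->
  core_mean (@fixed_leaves k.+1) g =
  \sum_(d | core_graph d && refines d g) lift_weight N d g * core_mean (@fixed_leaves k) d.
Proof.
move=> lN gc; have := @wreath_formula r w 'I_N g gc.
rewrite card_ord => /(_ lN N0 _ (@fixed_leaves k)) <-.
pose U := ('I_r * 'I_(size w).+1)%type.
pose h (x : {ffun U -> W}) : {ffun U -> S'} := [ffun u => wtree (x u)].
have h_bij : bijective h.
  have [v wK vK] := wtree_bij.
  exists (fun x : {ffun U -> S'} => [ffun u => v (x u)]) => x; apply/ffunP=> u;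
  by rewrite !ffunE ?wK ?vK.
rewrite /core_mean -(mean_bij _ h_bij).
pose q (sy : {ffun U -> 'S_N} * {ffun U * 'I_N -> S}) : {ffun U -> W} :=
  [ffun u => of_labels (sy.1 u) [ffun t => sy.2 (u, t)]].
have qE sy u : q sy u = of_labels (sy.1 u) [ffun t => sy.2 (u, t)] by rewrite ffunE.
have q_bij : bijective q.
  exists (fun x : {ffun U -> W} =>
    ([ffun u => (labels (x u)).1], [ffun ut => (labels (x ut.1)).2 ut.2])).
    case=> s y; congr pair; apply/ffunP=> u; rewrite ffunE qE of_labelsK //=.
    by rewrite ffunE -surjective_pairing.
  move=> x; apply/ffunP=> u; rewrite qE -[RHS]labelsK; congr of_labels.
    by rewrite ffunE.
  by apply/ffunP=> t; rewrite ffunE [LHS]ffunE.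
rewrite -(mean_bij _ q_bij).
rewrite -(mean_pair (fun (s : {ffun U -> 'S_N}) (y : {ffun U * 'I_N -> S}) =>
    let x u : perm_wreath S 'I_N := (s u, [ffun t => y (u, t)]) in
    \sum_(i | (word_value x (edge g)).1 i == i) fixed_leaves ((word_value x (edge g)).2 i))).
apply: eq_mean => -[s y] /=.
have wvM (A B : groupType) (m : A -> B) (x : U -> A) : {morph m : a b / (a * b)%g} ->
    m (word_value x (edge g)) = word_value (fun u => m (x u)) (edge g).
  move=> mM; have m1 : m 1%g = 1%g by apply: (@mulgI _ (m 1%g)); rewrite -mM !mulg1.
  have mV a : m (a^-1)%g = ((m a)^-1)%g by apply: (@mulgI _ (m a)); rewrite -mM !mulgV.
  by rewrite /word_value (big_morph m mM m1); apply: eq_bigr => j _; case: (sgn j); rewrite ?mV.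
transitivity (fixed_leaves (wtree (word_value (q (s, y)) (edge g)))).
  by congr fixed_leaves; rewrite (wvM _ _ _ _ wtreeM); apply: eq_word_value => j; rewrite ffunE.
have e : word_value (fun u => labels (q (s, y) u)) (edge g) =
         word_value (fun u => (s u, [ffun t => y (u, t)]) : perm_wreath S 'I_N) (edge g).
  by apply: eq_word_value => j; rewrite qE of_labelsK.
by rewrite fixed_leaves_wreath (wvM _ _ _ _ labelsM) e.
Qed.

End WreathTree.

(** * From core graphs to word expectations *)

Section Bouquet.
Variables (r : nat) (w : freegroup 'I_r).
Notation l := (size w).
Notation P := 'I_l.+1.

(** All positions are identified, so that one element is attached to each
    generator of w: this recovers independent uniform images of the
    generators. *)
Definition bouquet : {ffun P -> P} := [ffun=> ord0].

Lemma bouquet_core_graph : core_graph bouquet.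
Proof.
apply/and3P; split; last by rewrite /closed !ffunE.
  apply/eqP/ffunP=> p; rewrite [RHS]ffunE; apply/val_inj/eqP.
  by rewrite -leqn0; apply: (@canon_min r w _ _ p ord0); rewrite !ffunE.
by apply/foldedP=> j k _; rewrite !ffunE !eqxx.
Qed.

Lemma mean_bouquet (G : finGroupType) (chi : G -> algC) :
  mean (fun x : {ffun 'I_r -> G} => chi (fg_lift x w)) =
  mean (fun x : {ffun 'I_r * P -> G} => chi (word_value x (edge bouquet))).
Proof.
transitivity (mean (fun x : {ffun 'I_r -> G} => chi (word_value x (@gen r w)))).
  by apply: eq_mean => x; rewrite (fg_lift_word_value bouquet).
by apply: mean_word_value => j k; rewrite -[in RHS]pair_eqE /= /pair_eq /= !ffunE eqxx andbT.
Qed.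

Lemma word_expectation_sub (gT : finGroupType) (G : {group gT}) (f : gT -> algC) :
  word_expectation G w f = core_mean (fun x : subg_of G => f (sgval x)) bouquet.
Proof.
rewrite /core_mean -(mean_bouquet (fun x : subg_of G => f (sgval x))) /word_expectation /mean.
pose h (x : {ffun 'I_r -> subg_of G}) : {ffun 'I_r -> gT} := [ffun i => sgval (x i)].
have h_inj : injective h.
  by move=> x y /ffunP e; apply/ffunP=> i; have := e i; rewrite !ffunE => /subg_inj.
have hE : [set x in ffun_on G] = h @: [set: {ffun 'I_r -> subg_of G}].
  apply/setP=> x; rewrite inE; apply/ffun_onP/imsetP => [xG|[y _ ->] i]; last first.
    by rewrite ffunE subgP.
  exists [ffun i => subg G (x i)]; rewrite ?inE //.
  by apply/ffunP=> i; rewrite !ffunE subgK.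
rewrite hE card_imset // cardsT big_imset /=; last by move=> x y _ _ /h_inj.
congr (_ / _); apply: eq_big => [x|x _]; first by rewrite inE.
congr f; rewrite /fg_lift (big_morph (@sgval _ G)
  (id1 := 1%g) (op1 := fun a b => (a * b)%g)) //.
by apply: eq_bigr => -[i []] _; rewrite /letter_eval /= ffunE.
Qed.

Lemma word_expectation_sym n : (0 < n)%N -> (l <= n)%N ->
  word_expectation [set: 'S_n]%G w (perm_character 'P [set: 'I_n]) = lift_sum n bouquet.
Proof.
move=> n0 ln; rewrite -mean_fix_lift_sum ?bouquet_core_graph //.
rewrite -(mean_bouquet (fun s : 'S_n => #|[set i | s i == i]|%:R)) /word_expectation /mean.
rewrite (_ : [set x in ffun_on _] = [set: {ffun 'I_r -> 'S_n}]); last first.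
  by apply/setP=> x; rewrite !inE; apply/ffun_onP=> i; rewrite inE.
rewrite cardsT; congr (_ / _); apply: eq_big => [x|x _]; first by rewrite inE.
rewrite /perm_character; congr _%:R; apply: eq_card => i.
by rewrite in_fixed_points !inE.
Qed.

End Bouquet.

Lemma tree_tower r (w : freegroup 'I_r) m (n : nat -> nat) :
  (forall i, (1 <= i <= m)%N -> (0 < n i)%N /\ (size w <= n i)%N) ->
  tower (w := w) m n (fun k => core_mean (@fixed_leaves n k)).
Proof.
move=> nok.
have chi0 x : @fixed_leaves n 0 x = 1.
  rewrite /fixed_leaves /perm_character.
  rewrite (_ : 'Fix_(_ | _)[_]%g = [set: vertex n 0]) ?cardsT ?card_unit //.
  apply/setP=> -[]; rewrite in_fixed_points !inE; case: (sgval x tt); rewrite eqxx andbT.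
  by apply/forallP=> u.
have c0 (T : finType) : (0 < #|{: {ffun T -> subg_of (tree_aut_group n 0)}}|)%N.
  by apply/card_gt0P; exists [ffun=> 1%g].
split=> // [d _|k d km dc du|k g km gc].
- by rewrite /core_mean (eq_mean (F' := fun=> 1)) ?mean_const.
- rewrite du; elim: k km => [|k IHk] km.
    rewrite (eq_mean (F' := fun=> 1)) ?mean_const //.
    by apply/card_gt0P; exists 1%g.
  by have [n0 _] := nok k.+1 km; apply: mean_fixed_leaves => //; apply/IHk/ltnW.
- by have [n0 ln] := nok k.+1 km; apply: core_mean_level.
Qed.

(** The trivial subgroup has the empty basis, which contains no element. *)
Lemma primitivity_rank1 r : primitivity_rank (1%g : freegroup 'I_r) = Some 0%N.
Proof.
have h0 : nonprimitive_rank (1%g : freegroup 'I_r) 0.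
  have u1 (u : freegroup 'I_0) : u = 1%g by apply/val_inj; case: u => [[|[[i]]]].
  exists (fun x => x = 1%g); split=> //.
  - by split=> // x y -> ->; rewrite mulgV.
  - exists (fun _ => 1%g); split=> [u v _|x]; first by rewrite (u1 u) (u1 v).
    split=> [->|[u <-]]; first by exists 1%g; rewrite fg_lift1.
    by rewrite (u1 u) fg_lift1.
  - case=> I [b [[b_inj _] [i bi]]].
    have /(congr1 val) // : fg_gen i = 1%g by apply: b_inj; rewrite fg_lift_gen fg_lift1.
rewrite /primitivity_rank; case: pselect => [ex|ne]; last first.
  by case: ne; exists 0%N; apply/asboolP.
case: ex_minnP => k _ /(_ 0%N) H; congr Some; apply/eqP; rewrite -leqn0; apply: H.
exact/asboolP.
Qed.

Lemma card_leaves2 (n : nat -> nat) : (0 < n 1)%N -> (0 < n 2)%N ->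
  (#|leaves n 2| <= n 1 * n 2)%N.
Proof.
move=> n1 n2; pose h (q : 'I_(n 1) * 'I_(n 2)) : vertex n 2 := Some (q.2, Some (q.1, tt)).
apply: (@leq_trans #|h @: [set: 'I_(n 1) * 'I_(n 2)]|); last first.
  by apply: leq_trans (leq_imset_card _ _) _; rewrite cardsT card_prod !card_ord.
apply/subset_leq_card/subsetP=> v; rewrite leafE //; case: v => [[i u]|] // ul.
have := @leafE n 0 n1 u; rewrite ul {ul}; case: u => [[j []]|] // _.
by apply/imsetP; exists (j, i); rewrite ?inE.
Qed.

Lemma word_expectation1 r (gT : finGroupType) (G : {group gT}) (f : gT -> algC) :
  word_expectation G (1%g : freegroup 'I_r) f = f 1%g.
Proof.
rewrite word_expectation_sub /core_mean.
rewrite -(mean_bouquet (1%g : freegroup 'I_r) (fun x : subg_of G => f (sgval x))).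
rewrite (eq_mean (F' := fun=> f 1%g)) => [|x]; last by rewrite fg_lift1.
by rewrite mean_const //; apply/card_gt0P; exists [ffun=> 1%g].
Qed.

Theorem corollary1p13 (m : nat) (hm : (2 <= m)%N) :
  (forall n : nat -> nat, tree_aut n m \isog [set: iterated_wreath 'I_1 n m]) /\
  (forall (r : nat) (w : freegroup 'I_r),
     (* for w = 1 and m > 2 the bound is false *)
     (w = 1%g -> m = 2%N) ->
     exists C : algC, forall n : nat -> nat,
       (forall i : nat, (1 <= i <= m)%N -> (0 < n i)%N /\ (size w <= n i)%N) ->
       `| word_expectation (tree_aut_group n m) w
            (perm_character 'P (leaves n m))
          - word_expectation [set: 'S_(n m)]%G w
            (perm_character 'P [set: 'I_(n m)]) |
       <= C * pow_1_sub ((n m.-1 * n m)%:R) (primitivity_rank w)).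
Proof.
split=> [n|r w wm]; first exact: tree_aut_wreath.
have [w1|/eqP w1] := eqVneq w 1%g.
  rewrite (wm w1) w1; exists 2 => n nok.
  have [n1 _] := nok 1%N isT; have [n2 _] := nok 2%N isT.
  rewrite !word_expectation1 primitivity_rank1 /pow_1_sub subr0 expr1z.
  apply: le_trans (ler_normB _ _) _; rewrite /perm_character !normr_nat mulr2n mulrDl mul1r.
  apply: lerD; rewrite ler_nat.
    by apply: leq_trans (subset_leq_card (subsetIl _ _)) (card_leaves2 n1 n2).
  apply: leq_trans (subset_leq_card (subsetIl _ _)) _.
  by rewrite cardsT card_ord leq_pmull.
case: m hm {wm} => [|[|k]] // _.
have [C C0 HC] := tower_close w1 k; exists C => n nok.
have [n0 ln] := nok k.+2 (leqnn _).
rewrite word_expectation_sub word_expectation_sym //.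
exact: HC (tree_tower nok) _ (bouquet_core_graph w).
Qed.
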